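(* The bilattice Nagata product functor (respectively, the restricted sesquilattice Nagata product functor) from the category of cyclic pointed unital residuated lattice-ordered bimodules over a residuated lattice to the category of Nagata bilattices (respectively, restricted Nagata sesquilattices), together with the structural bimodule functor in the opposite direction, form a categorical equivalence. The unit of this equivalence is the isomorphism $m\mapsto\langle\sigma m,\gamma m\rangle$ and the counit is the inverse of the isomorphism $\langle e_S,e_M\rangle$.
   Context: Bimodules: $\mathbf S=\langle S,\wedge,\vee,\cdot,1,\backslash,/\rangle$ is a residuated lattice and $\mathbf M$ a lattice (elements of $S$: $a,b,c$; of $M$: $x,y,z$), with isotone actions $a*x$, $x*a$ in $M$ satisfying $(ab)*x=a*(b*x)$, $x*(ab)=(x*a)*b$, $(a*x)*b=a*(x*b)$, $1*x=x=x*1$, with residuals $\backslash_\ell,/_\ell,\backslash_r,/_r$ such that $x\le a\backslash_\ell y\iff a*x\le y\iff a\le y/_\ell x$, $x\le y/_r a\iff x*a\le y\iff a\le x\backslash_r y$, and a constant $0\in M$ with $a*0=0*a$ for all $a$. Morphisms preserve all operations and constants. The Nagata product has universe $S\times M$, componentwise lattice order, $\langle a,x\rangle\circ\langle b,y\rangle=\langle ab,x*b\vee a*y\rangle$, residuals $\langle a,x\rangle\backslash\langle b,y\rangle=\langle a\backslash b\wedge x\backslash_r y,a\backslash_\ell y\rangle$, $\langle a,x\rangle/\langle b,y\rangle=\langle a/b\wedge x/_\ell y,x/_r b\rangle$, constants $\langle 1,0\rangle$ and $e_M(0)$, maps $\sigma\langle a,x\rangle=\langle a,a*0\rangle$, $\gamma\langle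 a,x\rangle=\langle 0\backslash_r x,x\rangle$; $e_S(a)=\langle a,a*0\rangle$, $e_M(x)=\langle 0\backslash_r x,x\rangle$. The bilattice Nagata product expands it by $\langle a,x\rangle\oplus\langle b,y\rangle=\langle a\wedge b,x\vee y\rangle$ and $\langle a,x\rangle\otimes\langle b,y\rangle=\langle a\vee b,x\wedge y\rangle$. The restricted sesquilattice Nagata product is the subalgebra on $\{\langle a,x\rangle:0*a\le x,a*0\le x\}$ (without $\otimes$) expanded by $\oplus$. Nagata lattices and restricted Nagata lattices: for idempotent isotone $\gamma$ write $N_\gamma=\gamma[N]$; a pre-conucleus is an idempotent isotone $\sigma$ with $N_\sigma$ a subsemigroup; a $\sigma$-closure operator is idempotent isotone $\gamma$ with $a x\le\gamma(ax)$, $xa\le\gamma(xa)$ for $a\in N_\sigma,x\in N_\gamma$; $\sigma$-structural means $a\gamma m\le\gamma(am)$, $\gamma m\, a\le\gamma(ma)$ for $a\in N_\sigma$. A Nagata lattice is a residuated $\ell$-semigroup with pre-conucleus $\sigma$, $\sigma$-structural $\sigma$-closure operator $\gamma$, constants $1\in N_\sigma$, $0\in N_\gamma$ satisfying $\sigma(xy)=\sigma x\sigma y$, $\gamma(xy)=\sigma x\gamma y\vee\gamma x\sigma y$, $\sigma(x\wedge y)=\sigma(\sigma x\wedge\sigma y)$, $\gamma(x\vee y)=\gamma(\gamma x\vee\gamma y)$, $\sigma(x\vee y)=\sigma x\vee\sigma y$, $\gamma(x\wedge y)=\gamma x\wedge\gamma y$, $\sigma(x\backslash y)=\sigma(\sigma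 x\backslash\sigma y\wedge\gamma x\backslash\gamma y)$, $\sigma(y/x)=\sigma(\sigma y/\sigma x\wedge\gamma y/\gamma x)$, $\sigma x\backslash\gamma y=\gamma(x\backslash y)$, $\gamma y/\sigma x=\gamma(y/x)$, $\sigma\gamma x=\sigma(0\backslash\gamma x)=\sigma(\gamma x/0)$, $\gamma\sigma x=\gamma(0\sigma x)=\gamma(\sigma x\,0)$, $1\le\sigma(x\backslash x)$, $1\le\sigma(x/x)$, $1\le\sigma(x\backslash y)\Rightarrow x\le y$, $1\le\sigma(y/x)\Rightarrow x\le y$. A restricted Nagata lattice is a residuated lattice with unital conucleus $\sigma$ (interior operator, $\sigma x\sigma y\le\sigma(xy)$, $\sigma1=1$), $\sigma$-structural closure operator $\gamma$, constant $0\in N_\gamma$, satisfying $\sigma(xy)=\sigma x\sigma y$, $xy=\sigma x\,y\vee x\,\sigma y$, $\sigma x\backslash y\wedge x\backslash\gamma y=x\backslash y$, $x/\sigma y\wedge\gamma x/y=x/y$, $\sigma x\backslash\gamma y=\gamma(x\backslash y)$, $\gamma y/\sigma x=\gamma(y/x)$, $\sigma\gamma x=\sigma(0\backslash\gamma x)=\sigma(\gamma x/0)$, $\gamma\sigma x=\gamma(0\sigma x)=\gamma(\sigma x\,0)$. A Nagata bilattice is a Nagata lattice with binary $\oplus,\otimes$ satisfying $\sigma(x\oplus y)=\sigma(x\wedge y)$, $\gamma(x\oplus y)=\gamma(x\vee y)$, $\sigma(x\otimes y)=\sigma(x\vee y)$, $\gamma(x\otimes y)=\gamma(x\wedge y)$.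 A restricted Nagata sesquilattice is a restricted Nagata lattice with binary $\oplus$ satisfying $\sigma(x\oplus y)=\sigma(x\wedge y)$, $\gamma(x\oplus y)=\gamma(x\vee y)$. Morphisms preserve all operations, $\sigma,\gamma$ and constants. The structural bimodule functor sends $\mathbf N$ to: scalars $N_\sigma$ (inherited multiplication and join, meet $\sigma(a\wedge b)$, residuals $\sigma(a\backslash b),\sigma(a/b)$, unit $\sigma 1$), module $N_\gamma$ (inherited meet, join $\gamma(x\vee y)$), actions $\gamma(a\cdot x)$, $\gamma(x\cdot a)$, residuals $x\backslash_r y=\sigma(x\backslash y)$, $a\backslash_\ell x=\gamma(a\backslash x)$, $y/_\ell x=\sigma(y/x)$, $x/_r a=\gamma(x/a)$, point $0$; morphisms go to restrictions.
   Formalization: The Nagata lattice axiom γ(xy) = σxγy ∨ γxσy is read with the join of N_γ, i.e. γ(xy) = γ(σxγy ∨ γxσy), because with the join of N it fails in Nagata products (e.g. over the two-element chain with bottom as point). *)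

(* Defs.v *)
From HB Require Import structures.
From mathcomp Require Import all_boot all_order.
From mathcomp Require Import boolp.

Set Implicit Arguments.
Unset Strict Implicit.
Unset Printing Implicit Defensive.

Import Order.Theory.
Local Open Scope order_scope.

Record category := Category {
  obj :> Type;
  hom : obj -> obj -> Type;
  idm : forall A, hom A A;
  comp : forall A B C, hom B C -> hom A B -> hom A C;
  comp1m : forall A B (f : hom A B), comp (idm B) f = f;
  compm1 : forall A B (f : hom A B), comp f (idm A) = f;
  compmA : forall A B C D (h : hom C D) (g : hom B C) (f : hom A B),
    comp h (comp g f) = comp (comp h g) f }.

Arguments hom {c}.
Arguments idm {c}.
Arguments comp {c A B C}.

Record functor (C D : category) := Functor {
  fobj :> C -> D;
  fmap : forall A B, hom A B -> hom (fobj A) (fobj B);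
  fmap1 : forall A, fmap (idm A) = idm (fobj A);
  fmapM : forall A B E (g : hom B E) (f : hom A B),
    fmap (comp g f) = comp (fmap g) (fmap f) }.

Arguments fmap {C D} _ {A B}.

Definition idF (C : category) : functor C C :=
  @Functor C C (fun A => A) (fun _ _ f => f)
    (fun _ => erefl) (fun _ _ _ _ _ => erefl).

Section Composition.
Variables (C D E : category) (G : functor D E) (F : functor C D).

Fact compF1 (A : C) : fmap G (fmap F (idm A)) = idm (G (F A)).
Proof. by rewrite !fmap1. Qed.

Fact compFM (A B K : C) (g : hom B K) (f : hom A B) :
  fmap G (fmap F (comp g f)) = comp (fmap G (fmap F g)) (fmap G (fmap F f)).
Proof. by rewrite !fmapM. Qed.

Definition compF : functor C E := Functor compF1 compFM.

End Composition.

Record natTrans (C D : category) (F G : functor C D) := NatTrans {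
  ntmap :> forall A, hom (F A) (G A);
  ntmapP : forall A B (f : hom A B),
    comp (ntmap B) (fmap F f) = comp (fmap G f) (ntmap A) }.

Definition inverses (C : category) (A B : C) (f : hom A B) (g : hom B A) :=
  comp g f = idm A /\ comp f g = idm B.

Definition isomorphism (C : category) (A B : C) (f : hom A B) :=
  exists g, inverses f g.

(** [F : C -> D] and [G : D -> C] form an (adjoint) equivalence with unit
    [eta] and counit [eps]: both are natural isomorphisms, and they satisfy
    the triangle identities of the adjunction with right adjoint [F]. *)
Record equivalence (C D : category) (F : functor C D) (G : functor D C)
    (eta : natTrans (idF D) (compF F G))
    (eps : natTrans (compF G F) (idF C)) : Prop := Equivalence {
  unit_iso : forall N, isomorphism (eta N);
  counit_iso : forall B, isomorphism (eps B);
  triangleG : forall N, comp (eps (G N)) (fmap G (eta N)) = idm (G N);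
  triangleF : forall B, comp (fmap F (eps B)) (eta (F B)) = idm (F B) }.

(** The display is a phantom argument which only affects printing; it is fixed
    once and for all so that all lattices live in one type of objects. *)
Notation disp0 := (Order.Disp tt tt).
Notation latType := (latticeType disp0).

Record residSig := ResidSig {
  rs_car :> latType;
  mul : rs_car -> rs_car -> rs_car;
  ldiv : rs_car -> rs_car -> rs_car;
  rdiv : rs_car -> rs_car -> rs_car }.

Arguments mul {r}.
Arguments ldiv {r}.
Arguments rdiv {r}.

Declare Scope nag_scope.
Local Open Scope nag_scope.
Notation "x * y" := (mul x y) : nag_scope.
Notation "x \ y" := (ldiv x y) (at level 40, left associativity) : nag_scope.
Notation "x / y" := (rdiv x y) : nag_scope.

Record isResidLSemigroup (R : residSig) : Prop := IsResidLSemigroup {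
  rmulA : associative (@mul R);
  le_ldiv : forall x y z : R, (y <= x \ z) = (x * y <= z);
  le_rdiv : forall x y z : R, (x <= z / y) = (x * y <= z) }.

Record isResidLattice (R : residSig) (e : R) : Prop := IsResidLattice {
  rl_lsemigroup : isResidLSemigroup R;
  rmul1x : left_id e (@mul R);
  rmulx1 : right_id e (@mul R) }.

Record residLattice := ResidLattice {
  rl_sig :> residSig;
  rl_one : rl_sig;
  rl_axioms : isResidLattice rl_one }.

Arguments rl_one {r}.

Record bimodSig := BimodSig {
  scal : residLattice;
  modl : latType;
  lact : scal -> modl -> modl;
  ract : modl -> scal -> modl;
  lact_ldiv : scal -> modl -> modl;
  lact_rdiv : modl -> modl -> scal;
  ract_ldiv : modl -> modl -> scal;
  ract_rdiv : modl -> scal -> modl;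
  pt : modl }.

Arguments lact {b}.
Arguments ract {b}.
Arguments lact_ldiv {b}.
Arguments lact_rdiv {b}.
Arguments ract_ldiv {b}.
Arguments ract_rdiv {b}.
Arguments pt {b}.

Notation "a *: x" := (lact a x) (at level 40) : nag_scope.
Notation "x :* a" := (ract x a) (at level 40) : nag_scope.
Notation "a \_l y" := (lact_ldiv a y) (at level 40) : nag_scope.
Notation "y /_l x" := (lact_rdiv y x) (at level 40) : nag_scope.
Notation "x \_r y" := (ract_ldiv x y) (at level 40) : nag_scope.
Notation "y /_r a" := (ract_rdiv y a) (at level 40) : nag_scope.

Record isBimodule (B : bimodSig) : Prop := IsBimodule {
  lact_homo : forall (a b : scal B) (x y : modl B),
    a <= b -> x <= y -> a *: x <= b *: y;
  ract_homo : forall (a b : scal B) (x y : modl B),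
    a <= b -> x <= y -> x :* a <= y :* b;
  lactM : forall (a b : scal B) (x : modl B), (a * b) *: x = a *: (b *: x);
  ractM : forall (a b : scal B) (x : modl B), x :* (a * b) = (x :* a) :* b;
  lractA : forall (a b : scal B) (x : modl B), (a *: x) :* b = a *: (x :* b);
  lact1 : forall x : modl B, rl_one *: x = x;
  ract1 : forall x : modl B, x :* rl_one = x;
  le_lact_ldiv : forall (a : scal B) (x y : modl B),
    (x <= a \_l y) = (a *: x <= y);
  le_lact_rdiv : forall (a : scal B) (x y : modl B),
    (a <= y /_l x) = (a *: x <= y);
  le_ract_rdiv : forall (a : scal B) (x y : modl B),
    (x <= y /_r a) = (x :* a <= y);
  le_ract_ldiv : forall (a : scal B) (x y : modl B),
    (a <= x \_r y) = (x :* a <= y);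
  pt_cyclic : forall a : scal B, a *: pt = pt :* a }.

Record bimodule := Bimodule {
  bm_sig :> bimodSig;
  bm_axioms : isBimodule bm_sig }.

Record isBimodHom (B B' : bimodSig) (f : scal B -> scal B')
    (g : modl B -> modl B') : Prop := IsBimodHom {
  bhS_meet : {morph f : a b / a `&` b};
  bhS_join : {morph f : a b / a `|` b};
  bhS_mul : {morph f : a b / a * b};
  bhS_one : f rl_one = rl_one;
  bhS_ldiv : {morph f : a b / a \ b};
  bhS_rdiv : {morph f : a b / a / b};
  bhM_meet : {morph g : x y / x `&` y};
  bhM_join : {morph g : x y / x `|` y};
  bh_lact : forall a x, g (a *: x) = f a *: g x;
  bh_ract : forall a x, g (x :* a) = g x :* f a;
  bh_lact_ldiv : forall a x, g (a \_l x) = f a \_l g x;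
  bh_lact_rdiv : forall x y, f (y /_l x) = g y /_l g x;
  bh_ract_ldiv : forall x y, f (x \_r y) = g x \_r g y;
  bh_ract_rdiv : forall a x, g (x /_r a) = g x /_r f a;
  bh_pt : g pt = pt }.

Record bimodHom (B B' : bimodule) := BimodHom {
  bhS : scal B -> scal B';
  bhM : modl B -> modl B';
  bhP : isBimodHom bhS bhM }.

Lemma isBimodHom_id (B : bimodSig) : @isBimodHom B B id id.
Proof. by []. Qed.

Lemma bimodHom_eq (B B' : bimodule) (h k : bimodHom B B') :
  bhS h =1 bhS k -> bhM h =1 bhM k -> h = k.
Proof.
case: h k => [f g p] [f' g' p'] /= /funext ef /funext eg; subst f' g'.
by rewrite (Prop_irrelevance p p').
Qed.

Definition bimodHom_id (B : bimodule) : bimodHom B B :=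
  BimodHom (@isBimodHom_id B).

Lemma isBimodHom_comp (A B C : bimodSig)
    (f' : scal B -> scal C) (g' : modl B -> modl C)
    (f : scal A -> scal B) (g : modl A -> modl B) :
  isBimodHom f' g' -> isBimodHom f g -> isBimodHom (f' \o f) (g' \o g).
Proof.
move=> ph pk; split.
- by move=> ? ? /=; rewrite (bhS_meet pk) (bhS_meet ph).
- by move=> ? ? /=; rewrite (bhS_join pk) (bhS_join ph).
- by move=> ? ? /=; rewrite (bhS_mul pk) (bhS_mul ph).
- by rewrite /= (bhS_one pk) (bhS_one ph).
- by move=> ? ? /=; rewrite (bhS_ldiv pk) (bhS_ldiv ph).
- by move=> ? ? /=; rewrite (bhS_rdiv pk) (bhS_rdiv ph).
- by move=> ? ? /=; rewrite (bhM_meet pk) (bhM_meet ph).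
- by move=> ? ? /=; rewrite (bhM_join pk) (bhM_join ph).
- by move=> ? ? /=; rewrite (bh_lact pk) (bh_lact ph).
- by move=> ? ? /=; rewrite (bh_ract pk) (bh_ract ph).
- by move=> ? ? /=; rewrite (bh_lact_ldiv pk) (bh_lact_ldiv ph).
- by move=> ? ? /=; rewrite (bh_lact_rdiv pk) (bh_lact_rdiv ph).
- by move=> ? ? /=; rewrite (bh_ract_ldiv pk) (bh_ract_ldiv ph).
- by move=> ? ? /=; rewrite (bh_ract_rdiv pk) (bh_ract_rdiv ph).
- by rewrite /= (bh_pt pk) (bh_pt ph).
Qed.

Definition bimodHom_comp (A B C : bimodule) (h : bimodHom B C)
    (k : bimodHom A B) : bimodHom A C :=
  BimodHom (isBimodHom_comp (bhP h) (bhP k)).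

Definition bimodCat : category.
Proof.
refine (@Category bimodule bimodHom bimodHom_id bimodHom_comp _ _ _);
  by move=> *; apply: bimodHom_eq.
Defined.

Record nagSig := NagSig {
  ns_resid :> residSig;
  ns_one : ns_resid;
  ns_zero : ns_resid;
  ns_sig : ns_resid -> ns_resid;
  ns_gam : ns_resid -> ns_resid }.

Arguments ns_one {n}.
Arguments ns_zero {n}.
Arguments ns_sig {n}.
Arguments ns_gam {n}.

Local Notation "'σ' x" := (ns_sig x) (at level 10, x at level 9).
Local Notation "'γ' x" := (ns_gam x) (at level 10, x at level 9).

(** The image of an idempotent map is its set of fixed points. *)
Definition img (T : eqType) (f : T -> T) : pred T := fun x => f x == x.
Arguments img {T} f x /.

Definition isotone (L : latType) (f : L -> L) := {homo f : x y / x <= y}.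
Definition idempotent_map (L : latType) (f : L -> L) := forall x, f (f x) = f x.

Record isPreConucleus (R : residSig) (s : R -> R) : Prop := IsPreConucleus {
  pc_isotone : isotone s;
  pc_idem : idempotent_map s;
  pc_mul : forall a b : R, a \in img s -> b \in img s -> a * b \in img s }.

Record isSigmaClosure (R : residSig) (s g : R -> R) : Prop := IsSigmaClosure {
  sc_isotone : isotone g;
  sc_idem : idempotent_map g;
  sc_l : forall a x : R, a \in img s -> x \in img g -> a * x <= g (a * x);
  sc_r : forall a x : R, a \in img s -> x \in img g -> x * a <= g (x * a) }.

Record isStructural (R : residSig) (s g : R -> R) : Prop := IsStructural {
  str_l : forall a m : R, a \in img s -> a * g m <= g (a * m);
  str_r : forall a m : R, a \in img s -> g m * a <= g (m * a) }.

(** In [ngamM], the outer [γ] on the right-hand side makes the join that of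
    [N_γ]; the join of [N] itself need not belong to [N_γ], not even in Nagata
    products. *)
Record isNagataLattice (N : nagSig) : Prop := IsNagataLattice {
  nres : isResidLSemigroup N;
  npreconucleus : isPreConucleus (@ns_sig N);
  nclosure : isSigmaClosure (@ns_sig N) (@ns_gam N);
  nstructural : isStructural (@ns_sig N) (@ns_gam N);
  none_sig : (ns_one : N) \in img ns_sig;
  nzero_gam : (ns_zero : N) \in img ns_gam;
  nsigM : forall x y : N, σ (x * y) = σ x * σ y;
  ngamM : forall x y : N, γ (x * y) = γ (σ x * γ y `|` γ x * σ y);
  nsigI : forall x y : N, σ (x `&` y) = σ (σ x `&` σ y);
  ngamU : forall x y : N, γ (x `|` y) = γ (γ x `|` γ y);
  nsigU : forall x y : N, σ (x `|` y) = σ x `|` σ y;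
  ngamI : forall x y : N, γ (x `&` y) = γ x `&` γ y;
  nsig_ldiv : forall x y : N, σ (x \ y) = σ (σ x \ σ y `&` γ x \ γ y);
  nsig_rdiv : forall x y : N, σ (y / x) = σ (σ y / σ x `&` γ y / γ x);
  ngam_ldiv : forall x y : N, σ x \ γ y = γ (x \ y);
  ngam_rdiv : forall x y : N, γ y / σ x = γ (y / x);
  nsig_gam_l : forall x : N, σ (γ x) = σ (ns_zero \ γ x);
  nsig_gam_r : forall x : N, σ (γ x) = σ (γ x / ns_zero);
  ngam_sig_l : forall x : N, γ (σ x) = γ (ns_zero * σ x);
  ngam_sig_r : forall x : N, γ (σ x) = γ (σ x * ns_zero);
  nle1_ldiv : forall x : N, ns_one <= σ (x \ x);
  nle1_rdiv : forall x : N, ns_one <= σ (x / x);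
  nle_ldiv : forall x y : N, ns_one <= σ (x \ y) -> x <= y;
  nle_rdiv : forall x y : N, ns_one <= σ (y / x) -> x <= y }.

Record isRestrNagataLattice (N : nagSig) : Prop := IsRestrNagataLattice {
  rres : isResidLattice (@ns_one N);
  rsig_isotone : isotone (@ns_sig N);
  rsig_idem : idempotent_map (@ns_sig N);
  rsig_le : forall x : N, σ x <= x;
  rsig_lax : forall x y : N, σ x * σ y <= σ (x * y);
  rsig_one : σ ns_one = ns_one :> N;
  rgam_isotone : isotone (@ns_gam N);
  rgam_idem : idempotent_map (@ns_gam N);
  rgam_ge : forall x : N, x <= γ x;
  rstructural : isStructural (@ns_sig N) (@ns_gam N);
  rzero_gam : (ns_zero : N) \in img ns_gam;
  rsigM : forall x y : N, σ (x * y) = σ x * σ y;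
  rmulE : forall x y : N, x * y = σ x * y `|` x * σ y;
  rldivE : forall x y : N, σ x \ y `&` x \ γ y = x \ y;
  rrdivE : forall x y : N, x / σ y `&` γ x / y = x / y;
  rgam_ldiv : forall x y : N, σ x \ γ y = γ (x \ y);
  rgam_rdiv : forall x y : N, γ y / σ x = γ (y / x);
  rsig_gam_l : forall x : N, σ (γ x) = σ (ns_zero \ γ x);
  rsig_gam_r : forall x : N, σ (γ x) = σ (γ x / ns_zero);
  rgam_sig_l : forall x : N, γ (σ x) = γ (ns_zero * σ x);
  rgam_sig_r : forall x : N, γ (σ x) = γ (σ x * ns_zero) }.

Record nagataBilattice := NagataBilattice {
  nb_sig :> nagSig;
  nb_oplus : nb_sig -> nb_sig -> nb_sig;
  nb_otimes : nb_sig -> nb_sig -> nb_sig;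
  nb_axioms : isNagataLattice nb_sig;
  nb_sig_oplus : forall x y, σ (nb_oplus x y) = σ (x `&` y);
  nb_gam_oplus : forall x y, γ (nb_oplus x y) = γ (x `|` y);
  nb_sig_otimes : forall x y, σ (nb_otimes x y) = σ (x `|` y);
  nb_gam_otimes : forall x y, γ (nb_otimes x y) = γ (x `&` y) }.

Arguments nb_oplus {n}.
Arguments nb_otimes {n}.

Record restrNagataSesquilattice := RestrNagataSesquilattice {
  rn_sig :> nagSig;
  rn_oplus : rn_sig -> rn_sig -> rn_sig;
  rn_axioms : isRestrNagataLattice rn_sig;
  rn_sig_oplus : forall x y, σ (rn_oplus x y) = σ (x `&` y);
  rn_gam_oplus : forall x y, γ (rn_oplus x y) = γ (x `|` y) }.

Arguments rn_oplus {r}.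

Record isNagHom (N N' : nagSig) (f : N -> N') : Prop := IsNagHom {
  nh_meet : {morph f : x y / x `&` y};
  nh_join : {morph f : x y / x `|` y};
  nh_mul : {morph f : x y / x * y};
  nh_ldiv : {morph f : x y / x \ y};
  nh_rdiv : {morph f : x y / x / y};
  nh_one : f ns_one = ns_one;
  nh_zero : f ns_zero = ns_zero;
  nh_sig : {morph f : x / σ x};
  nh_gam : {morph f : x / γ x} }.

Lemma isNagHom_id (N : nagSig) : isNagHom (@id N).
Proof. by []. Qed.

Lemma isNagHom_comp (A B C : nagSig) (g : B -> C) (f : A -> B) :
  isNagHom g -> isNagHom f -> isNagHom (g \o f).
Proof.
move=> pg pf; split.
- by move=> ? ? /=; rewrite (nh_meet pf) (nh_meet pg).
- by move=> ? ? /=; rewrite (nh_join pf) (nh_join pg).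
- by move=> ? ? /=; rewrite (nh_mul pf) (nh_mul pg).
- by move=> ? ? /=; rewrite (nh_ldiv pf) (nh_ldiv pg).
- by move=> ? ? /=; rewrite (nh_rdiv pf) (nh_rdiv pg).
- by rewrite /= (nh_one pf) (nh_one pg).
- by rewrite /= (nh_zero pf) (nh_zero pg).
- by move=> ? /=; rewrite (nh_sig pf) (nh_sig pg).
- by move=> ? /=; rewrite (nh_gam pf) (nh_gam pg).
Qed.

Record bilatHom (N N' : nagataBilattice) := BilatHom {
  bl_fun :> N -> N';
  bl_nag : isNagHom bl_fun;
  bl_oplus : {morph bl_fun : x y / nb_oplus x y};
  bl_otimes : {morph bl_fun : x y / nb_otimes x y} }.

Lemma bilatHom_eq (N N' : nagataBilattice) (f g : bilatHom N N') :
  f =1 g -> f = g.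
Proof.
case: f g => [f p q r] [g p' q' r'] /= /funext e; subst g.
by rewrite (Prop_irrelevance p p') (Prop_irrelevance q q')
           (Prop_irrelevance r r').
Qed.

Definition bilatHom_id (N : nagataBilattice) : bilatHom N N :=
  @BilatHom N N id (@isNagHom_id N) (fun _ _ => erefl) (fun _ _ => erefl).

Section BilatHomComp.
Variables (A B C : nagataBilattice) (g : bilatHom B C) (f : bilatHom A B).

Fact comp_oplus : {morph (g \o f) : x y / nb_oplus x y}.
Proof. by move=> x y /=; rewrite !bl_oplus. Qed.
Fact comp_otimes : {morph (g \o f) : x y / nb_otimes x y}.
Proof. by move=> x y /=; rewrite !bl_otimes. Qed.

Definition bilatHom_comp : bilatHom A C :=
  BilatHom (isNagHom_comp (bl_nag g) (bl_nag f)) comp_oplus comp_otimes.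

End BilatHomComp.

Definition bilatCat : category.
Proof.
refine (@Category nagataBilattice bilatHom bilatHom_id bilatHom_comp _ _ _);
  by move=> *; apply: bilatHom_eq.
Defined.

Record sesquiHom (N N' : restrNagataSesquilattice) := SesquiHom {
  sq_fun :> N -> N';
  sq_nag : isNagHom sq_fun;
  sq_oplus : {morph sq_fun : x y / rn_oplus x y} }.

Lemma sesquiHom_eq (N N' : restrNagataSesquilattice) (f g : sesquiHom N N') :
  f =1 g -> f = g.
Proof.
case: f g => [f p q] [g p' q'] /= /funext e; subst g.
by rewrite (Prop_irrelevance p p') (Prop_irrelevance q q').
Qed.

Definition sesquiHom_id (N : restrNagataSesquilattice) : sesquiHom N N :=
  @SesquiHom N N id (@isNagHom_id N) (fun _ _ => erefl).

Section SesquiHomComp.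
Variables (A B C : restrNagataSesquilattice).
Variables (g : sesquiHom B C) (f : sesquiHom A B).

Fact comp_sesqui_oplus : {morph (g \o f) : x y / rn_oplus x y}.
Proof. by move=> x y /=; rewrite !sq_oplus. Qed.

Definition sesquiHom_comp : sesquiHom A C :=
  SesquiHom (isNagHom_comp (sq_nag g) (sq_nag f)) comp_sesqui_oplus.

End SesquiHomComp.

Definition sesquiCat : category.
Proof.
refine (@Category restrNagataSesquilattice sesquiHom
          sesquiHom_id sesquiHom_comp _ _ _);
  by move=> *; apply: sesquiHom_eq.
Defined.

Section BimoduleTheory.
Variable B : bimodule.
Implicit Types (a b c : scal B) (x y z : modl B).

Lemma rmulAS a b c : a * (b * c) = a * b * c.
Proof. exact: rmulA (rl_lsemigroup (rl_axioms _)) _ _ _. Qed.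
Lemma le_ldivS a b c : (b <= a \ c) = (a * b <= c).
Proof. exact: le_ldiv (rl_lsemigroup (rl_axioms _)) _ _ _. Qed.
Lemma le_rdivS a b c : (a <= c / b) = (a * b <= c).
Proof. exact: le_rdiv (rl_lsemigroup (rl_axioms _)) _ _ _. Qed.

Lemma eq_lex (L : latType) (u v : L) : (forall w, (w <= u) = (w <= v)) -> u = v.
Proof. by move=> e; apply/le_anti; rewrite -e lexx e lexx. Qed.
Lemma eq_gex (L : latType) (u v : L) : (forall w, (u <= w) = (v <= w)) -> u = v.
Proof. by move=> e; apply/le_anti; rewrite e lexx -e lexx. Qed.

Lemma lactU a x y : a *: (x `|` y) = a *: x `|` a *: y.
Proof.
by apply: eq_gex => w; rewrite leUx -!(le_lact_ldiv (bm_axioms B)) leUx.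
Qed.
Lemma Ulact a b x : (a `|` b) *: x = a *: x `|` b *: x.
Proof.
by apply: eq_gex => w; rewrite leUx -!(le_lact_rdiv (bm_axioms B)) leUx.
Qed.
Lemma ractU a x y : (x `|` y) :* a = x :* a `|` y :* a.
Proof.
by apply: eq_gex => w; rewrite leUx -!(le_ract_rdiv (bm_axioms B)) leUx.
Qed.
Lemma Uract a b x : x :* (a `|` b) = x :* a `|` x :* b.
Proof.
by apply: eq_gex => w; rewrite leUx -!(le_ract_ldiv (bm_axioms B)) leUx.
Qed.

End BimoduleTheory.

Definition nprod (B : bimodule) : latType := scal B *prod[disp0] modl B.

Section NagataProduct.
Variable B : bimodule.
Implicit Types (p q : nprod B).

Definition np_mul p q : nprod B := (p.1 * q.1, p.2 :* q.1 `|` p.1 *: q.2).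
Definition np_ldiv p q : nprod B :=
  (p.1 \ q.1 `&` p.2 \_r q.2, p.1 \_l q.2).
Definition np_rdiv p q : nprod B :=
  (p.1 / q.1 `&` p.2 /_l q.2, p.2 /_r q.1).

Definition eS (a : scal B) : nprod B := (a, a *: pt).
Definition eM (x : modl B) : nprod B := (pt \_r x, x).

Definition np_one : nprod B := (rl_one, pt).
Definition np_zero : nprod B := eM pt.
Definition np_sig p : nprod B := (p.1, p.1 *: pt).
Definition np_gam p : nprod B := (pt \_r p.2, p.2).

Definition np_oplus p q : nprod B := (p.1 `&` q.1, p.2 `|` q.2).
Definition np_otimes p q : nprod B := (p.1 `|` q.1, p.2 `&` q.2).

Definition np_resid : residSig := ResidSig np_mul np_ldiv np_rdiv.

Definition nagataProduct : nagSig :=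
  @NagSig np_resid np_one np_zero np_sig np_gam.

Let HB := bm_axioms B.

Lemma np_lsemigroup : isResidLSemigroup np_resid.
Proof.
split=> /=.
- move=> [a x] [b y] [c z]; rewrite /np_mul /=; congr (_, _).
    exact: rmulAS.
  by rewrite (ractM HB) (lactM HB) ractU lactU (lractA HB) joinA.
- move=> [a x] [b y] [c z]; rewrite !leEprod /= lexI leUx le_ldivS.
  by rewrite (le_ract_ldiv HB) (le_lact_ldiv HB) andbA.
- move=> [a x] [b y] [c z]; rewrite !leEprod /= lexI leUx le_rdivS.
  by rewrite (le_lact_rdiv HB) (le_ract_rdiv HB) -andbA [X in _ && X]andbC.
Qed.

Lemma lact_pt (a : scal B) : a *: pt = pt :* a. Proof. exact: pt_cyclic. Qed.

Lemma pt_lact_ract (a c : scal B) : (a *: pt) :* c = pt :* (a * c).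
Proof. by rewrite lact_pt (ractM HB). Qed.

Lemma ract_ptA (a c : scal B) : pt :* (a * c) = a *: (pt :* c).
Proof. by rewrite -lact_pt (lactM HB) lact_pt. Qed.

Lemma pt_ldiv_le (y : modl B) : pt :* (pt \_r y) <= y.
Proof. by rewrite -(le_ract_ldiv HB). Qed.

Lemma le_pt_ldiv (c : scal B) (y : modl B) : (c <= pt \_r y) = (pt :* c <= y).
Proof. exact: le_ract_ldiv. Qed.

Lemma lact_homo_r (a : scal B) (x y : modl B) : x <= y -> a *: x <= a *: y.
Proof. by move=> h; apply: (lact_homo HB). Qed.

Lemma ract_homo_r (a : scal B) (x y : modl B) : x <= y -> x :* a <= y :* a.
Proof. by move=> h; apply: (ract_homo HB). Qed.

Lemma ract_ldiv_le (x y : modl B) : x :* (x \_r y) <= y.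
Proof. by rewrite -(le_ract_ldiv HB). Qed.

Lemma lact_rdiv_le (x y : modl B) : (y /_l x) *: x <= y.
Proof. by rewrite -(le_lact_rdiv HB). Qed.

Lemma ldiv_le (a b : scal B) : a * (a \ b) <= b.
Proof. by rewrite -le_ldivS. Qed.

Lemma rdiv_le (a b : scal B) : (b / a) * a <= b.
Proof. by rewrite -le_rdivS. Qed.

Lemma pt_homo (a b : scal B) : a <= b -> a *: pt <= b *: pt.
Proof. by move=> h; apply: (lact_homo HB). Qed.

Lemma lact_pt_ract_pt_ldiv (a : scal B) (y : modl B) :
  (a *: pt) :* (pt \_r y) <= a *: y.
Proof. by rewrite (lractA HB); apply: lact_homo_r; apply: pt_ldiv_le. Qed.

Lemma pt_ldiv_lact_pt (a : scal B) (x : modl B) :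
  (pt \_r x) *: (a *: pt) <= x :* a.
Proof.
rewrite [a *: pt]lact_pt -(lractA HB) lact_pt.
by apply: ract_homo_r; apply: pt_ldiv_le.
Qed.

Lemma np_sig_gamE p q : np_mul (np_sig p) (np_gam q) =
  (p.1 * (pt \_r q.2), p.1 *: q.2).
Proof.
by rewrite /np_mul /=; congr (_, _); apply: join_r; apply: lact_pt_ract_pt_ldiv.
Qed.

Lemma np_gam_sigE p q : np_mul (np_gam q) (np_sig p) =
  ((pt \_r q.2) * p.1, q.2 :* p.1).
Proof.
by rewrite /np_mul /=; congr (_, _); apply: join_l; apply: pt_ldiv_lact_pt.
Qed.

Lemma np_sigE p : (p \in img np_sig) -> p = np_sig p.
Proof. by move=> /eqP. Qed.
Lemma np_gamE p : (p \in img np_gam) -> p = np_gam p.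
Proof. by move=> /eqP. Qed.

Lemma np_sigM p q : np_sig (np_mul p q) = np_mul (np_sig p) (np_sig q).
Proof.
rewrite /np_sig /np_mul /=; congr (_, _).
by rewrite (lractA HB) -[pt :* _]lact_pt joinxx (lactM HB).
Qed.

Lemma np_sig_homo p q : p <= q -> np_sig p <= np_sig q.
Proof. by rewrite !leEprod /= => /andP[h _]; rewrite h pt_homo. Qed.

Lemma pt_ldiv_homo (x y : modl B) : x <= y -> pt \_r x <= pt \_r y.
Proof. by rewrite le_pt_ldiv; apply: le_trans; apply: pt_ldiv_le. Qed.

Lemma np_gam_homo p q : p <= q -> np_gam p <= np_gam q.
Proof. by rewrite !leEprod /= => /andP[_ h]; rewrite h andbT pt_ldiv_homo. Qed.

Lemma np_structural : @isStructural np_resid np_sig np_gam.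
Proof.
split=> p q /np_sigE ->.
  rewrite [_ * _]np_sig_gamE leEprod /= leUr andbT le_pt_ldiv.
  rewrite ract_ptA; apply: le_trans (leUr _ _).
  by apply: lact_homo_r; apply: pt_ldiv_le.
rewrite [_ * _]np_gam_sigE leEprod /= leUl andbT le_pt_ldiv.
rewrite (ractM HB); apply: le_trans (leUl _ _).
by apply: ract_homo_r; apply: pt_ldiv_le.
Qed.

Lemma np_ldiv_sig p q : (np_ldiv (np_sig p) (np_sig q)).1 = p.1 \ q.1.
Proof.
rewrite /=; apply: meet_l; rewrite (le_ract_ldiv HB).
by rewrite pt_lact_ract -lact_pt pt_homo // ldiv_le.
Qed.

Lemma np_rdiv_sig p q : (np_rdiv (np_sig p) (np_sig q)).1 = p.1 / q.1.
Proof.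
rewrite /=; apply: meet_l; rewrite (le_lact_rdiv HB).
by rewrite -(lactM HB) pt_homo // rdiv_le.
Qed.

Lemma np_ldiv_gam p q : (np_ldiv (np_gam p) (np_gam q)).1 = p.2 \_r q.2.
Proof.
rewrite /=; apply: meet_r; rewrite le_ldivS le_pt_ldiv (ractM HB).
by apply: le_trans (ract_ldiv_le p.2 q.2); apply/ract_homo_r/pt_ldiv_le.
Qed.

Lemma np_rdiv_gam p q : (np_rdiv (np_gam p) (np_gam q)).1 = p.2 /_l q.2.
Proof.
rewrite /=; apply: meet_r; rewrite le_rdivS le_pt_ldiv ract_ptA.
by apply: le_trans (lact_rdiv_le q.2 p.2); apply/lact_homo_r/pt_ldiv_le.
Qed.

Lemma np_eq_sig p q : p.1 = q.1 -> np_sig p = np_sig q.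
Proof. by rewrite /np_sig => ->. Qed.
Lemma np_eq_gam p q : p.2 = q.2 -> np_gam p = np_gam q.
Proof. by rewrite /np_gam => ->. Qed.

Lemma np_gam_ldiv p q : np_ldiv (np_sig p) (np_gam q) = np_gam (np_ldiv p q).
Proof.
rewrite /np_ldiv /np_gam /=; congr (_, _); apply: eq_lex => c.
rewrite lexI le_ldivS !le_pt_ldiv (le_ract_ldiv HB) pt_lact_ract andbb.
by rewrite ract_ptA (le_lact_ldiv HB).
Qed.

Lemma np_gam_rdiv p q : np_rdiv (np_gam q) (np_sig p) = np_gam (np_rdiv q p).
Proof.
rewrite /np_rdiv /np_gam /=; congr (_, _); apply: eq_lex => c.
rewrite lexI le_rdivS !le_pt_ldiv (le_lact_rdiv HB) -(lactM HB) lact_pt andbb.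
by rewrite (ractM HB) (le_ract_rdiv HB).
Qed.

Lemma np_sig_gam_l p : np_sig (np_gam p) = np_sig (np_ldiv np_zero (np_gam p)).
Proof. by apply: np_eq_sig; rewrite [RHS](np_ldiv_gam (rl_one, pt) p). Qed.

Lemma np_sig_gam_r p : np_sig (np_gam p) = np_sig (np_rdiv (np_gam p) np_zero).
Proof.
apply: np_eq_sig; rewrite [RHS](np_rdiv_gam p (rl_one, pt)).
by apply: eq_lex => c; rewrite /= le_pt_ldiv (le_lact_rdiv HB) lact_pt.
Qed.

Lemma np_gam_sig_l p : np_gam (np_sig p) = np_gam (np_mul np_zero (np_sig p)).
Proof.
apply: np_eq_gam; rewrite [np_mul _ _](np_gam_sigE p (rl_one, pt)) /=.
exact: lact_pt.
Qed.

Lemma np_gam_sig_r p : np_gam (np_sig p) = np_gam (np_mul (np_sig p) np_zero).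
Proof. by apply: np_eq_gam; rewrite [np_mul _ _](np_sig_gamE p (rl_one, pt)). Qed.

Lemma np_le1_sig p : rl_one <= p.1 -> np_one <= np_sig p.
Proof.
by move=> h; rewrite leEprod /= h /= -[X in X <= _](lact1 HB) pt_homo.
Qed.

Lemma nagataProductP : isNagataLattice nagataProduct.
Proof.
have npL := np_lsemigroup.
split=> //=.
- split=> /=; [exact: np_sig_homo | by [] |].
  move=> p q /np_sigE -> /np_sigE -> /=.
  by rewrite -np_sigM; apply/eqP.
- split=> /=; [exact: np_gam_homo | by [] | |].
    move=> p q pS /np_gamE ->; rewrite {1}[np_gam q]/(np_gam (np_gam q)).
    exact: (str_l np_structural).
  move=> p q pS /np_gamE ->; rewrite {1}[np_gam q]/(np_gam (np_gam q)).
  exact: (str_r np_structural).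
- exact: np_structural.
- by apply/eqP; rewrite /np_sig /np_one /= (lact1 HB).
- by apply/eqP.
- exact: np_sigM.
- move=> p q; apply: np_eq_gam.
  by rewrite [np_mul (np_sig p) _]np_sig_gamE np_gam_sigE /= joinC.
- by move=> p q; rewrite /np_sig /= Ulact.
- move=> p q; rewrite /np_gam /=; congr (_, _).
  by apply: eq_lex => c; rewrite lexI !le_pt_ldiv lexI.
- move=> p q; apply: np_eq_sig; rewrite [RHS]/(_ `&` _).
  by rewrite -[X in _ = X `&` _]/(np_ldiv (np_sig p) (np_sig q)).1
     -[X in _ = _ `&` X]/(np_ldiv (np_gam p) (np_gam q)).1 np_ldiv_sig np_ldiv_gam.
- move=> p q; apply: np_eq_sig; rewrite [RHS]/(_ `&` _).
  by rewrite -[X in _ = X `&` _]/(np_rdiv (np_sig q) (np_sig p)).1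
     -[X in _ = _ `&` X]/(np_rdiv (np_gam q) (np_gam p)).1 np_rdiv_sig np_rdiv_gam.
- exact: np_gam_ldiv.
- by move=> p q; apply: np_gam_rdiv.
- exact: np_sig_gam_l.
- exact: np_sig_gam_r.
- exact: np_gam_sig_l.
- exact: np_gam_sig_r.
- move=> p; apply: np_le1_sig; rewrite /= lexI le_ldivS (le_ract_ldiv HB).
  by rewrite (rmulx1 (rl_axioms _)) (ract1 HB) !lexx.
- move=> p; apply: np_le1_sig; rewrite /= lexI le_rdivS (le_lact_rdiv HB).
  by rewrite (rmul1x (rl_axioms _)) (lact1 HB) !lexx.
- move=> p q; rewrite leEprod /= lexI le_ldivS (le_ract_ldiv HB).
  by rewrite (rmulx1 (rl_axioms _)) (ract1 HB) leEprod => /andP[].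
- move=> p q; rewrite leEprod /= lexI le_rdivS (le_lact_rdiv HB).
  by rewrite (rmul1x (rl_axioms _)) (lact1 HB) leEprod => /andP[].
Qed.

Definition bilatticeNagataProduct : nagataBilattice :=
  @NagataBilattice nagataProduct np_oplus np_otimes nagataProductP
    (fun _ _ => erefl) (fun _ _ => erefl) (fun _ _ => erefl) (fun _ _ => erefl).

Definition restricted : pred (nprod B) :=
  fun p => (pt :* p.1 <= p.2) && (p.1 *: pt <= p.2).

End NagataProduct.

Definition rprod (B : bimodule) : Type := {p : nprod B | restricted p}.

HB.instance Definition _ (B : bimodule) := SubType.on (rprod B).
HB.instance Definition _ (B : bimodule) := [Choice of rprod B by <:].
HB.instance Definition _ (B : bimodule) :=
  [SubChoice_isSubPOrder of rprod B by <: with disp0].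

Section RestrictedNagataProduct.
Variable B : bimodule.
Implicit Types (u v w : rprod B).

Let HB := bm_axioms B.

Lemma restrictedE (p : nprod B) : restricted p = (p.1 *: pt <= p.2).
Proof. by rewrite /restricted -lact_pt andbb. Qed.

Lemma rprodP u : (val u).1 *: pt <= (val u).2.
Proof. by rewrite -restrictedE (valP u). Qed.

Fact restricted_meet u v : restricted (val u `&` val v).
Proof.
by rewrite restrictedE /= lexI !(le_trans (pt_homo _) (rprodP _)) ?leIl ?leIr.
Qed.

Fact restricted_join u v : restricted (val u `|` val v).
Proof. by rewrite restrictedE /= Ulact leU2 ?rprodP. Qed.

Fact restricted_mul u v : restricted (np_mul (val u) (val v)).
Proof.
rewrite restrictedE /= (lactM HB); apply: le_trans (leUr _ _).
exact/lact_homo_r/rprodP.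
Qed.

Fact restricted_ldiv u v : restricted (np_ldiv (val u) (val v)).
Proof.
rewrite restrictedE /= (le_lact_ldiv HB) -(lactM HB).
apply: le_trans (rprodP v); apply: pt_homo.
by rewrite -le_ldivS leIl.
Qed.

Fact restricted_rdiv u v : restricted (np_rdiv (val u) (val v)).
Proof.
rewrite restrictedE /= (le_ract_rdiv HB) lact_pt -(ractM HB) -lact_pt.
apply: le_trans (rprodP u); apply: pt_homo.
by rewrite -le_rdivS leIl.
Qed.

Fact restricted_one : restricted (np_one B).
Proof. by rewrite restrictedE /= (lact1 HB). Qed.

Fact restricted_gam (p : nprod B) : restricted (np_gam p).
Proof. by rewrite restrictedE /= lact_pt pt_ldiv_le. Qed.

Fact restricted_sig (p : nprod B) : restricted (np_sig p).
Proof. by rewrite restrictedE /=. Qed.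

Fact restricted_zero : restricted (np_zero B).
Proof. by rewrite restrictedE /= lact_pt pt_ldiv_le. Qed.

Fact restricted_oplus u v : restricted (np_oplus (val u) (val v)).
Proof.
rewrite restrictedE /=; apply: le_trans (pt_homo (leIl _ _)) _.
by apply: le_trans (rprodP u) (leUl _ _).
Qed.

Definition rp_of (p : nprod B) (h : restricted p) : rprod B := exist _ p h.

Definition rp_meet u v : rprod B := rp_of (restricted_meet u v).
Definition rp_join u v : rprod B := rp_of (restricted_join u v).

Fact rp_lexI u v w : (u <= rp_meet v w) = (u <= v) && (u <= w).
Proof. by rewrite !leEsub /= lexI. Qed.
Fact rp_leUx u v w : (rp_join u v <= w) = (u <= w) && (v <= w).
Proof. by rewrite !leEsub /= leUx. Qed.

HB.instance Definition _ :=
  Order.POrder_MeetJoin_isLattice.Build disp0 (rprod B) rp_lexI rp_leUx.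

Definition rp_mul u v : rprod B := rp_of (restricted_mul u v).
Definition rp_ldiv u v : rprod B := rp_of (restricted_ldiv u v).
Definition rp_rdiv u v : rprod B := rp_of (restricted_rdiv u v).
Definition rp_one : rprod B := rp_of restricted_one.
Definition rp_zero : rprod B := rp_of restricted_zero.
Definition rp_sig u : rprod B := rp_of (restricted_sig (val u)).
Definition rp_gam u : rprod B := rp_of (restricted_gam (val u)).
Definition rp_oplus u v : rprod B := rp_of (restricted_oplus u v).

Definition restrictedNagataProduct : nagSig :=
  @NagSig (@ResidSig (rprod B : latType) rp_mul rp_ldiv rp_rdiv)
    rp_one rp_zero rp_sig rp_gam.

Lemma val_le u v : (u <= v) = (val u <= val v).
Proof. by rewrite leEsub. Qed.

Lemma rp_sig_le u : rp_sig u <= u.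
Proof. by rewrite val_le leEprod /= lexx rprodP. Qed.

Lemma rp_gam_ge u : u <= rp_gam u.
Proof. by rewrite val_le leEprod /= lexx andbT le_pt_ldiv -lact_pt rprodP. Qed.

Lemma restrictedNagataProductP : isRestrNagataLattice restrictedNagataProduct.
Proof.
have NP := nagataProductP B; have RP := nres NP.
split=> /=.
- split.
  + split=> [u v w|u v w|u v w].
    * by apply: val_inj; apply: (rmulA RP).
    * by rewrite !val_le; apply: (le_ldiv RP).
    * by rewrite !val_le; apply: (le_rdiv RP).
  + move=> u; apply: val_inj; rewrite /= /np_mul /= (rmul1x (rl_axioms _)).
    rewrite (lact1 HB) join_r -?surjective_pairing //.
    by rewrite -lact_pt rprodP.
  + move=> u; apply: val_inj; rewrite /= /np_mul /= (rmulx1 (rl_axioms _)).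
    by rewrite (ract1 HB) join_l -?surjective_pairing // rprodP.
- by move=> u v; rewrite !val_le; apply: np_sig_homo.
- by move=> u; apply: val_inj.
- exact: rp_sig_le.
- by move=> u v; rewrite val_le /= np_sigM.
- by apply: val_inj; rewrite /= /np_sig /= (lact1 HB).
- by move=> u v; rewrite !val_le; apply: np_gam_homo.
- by move=> u; apply: val_inj.
- exact: rp_gam_ge.
- split=> u v /eqP /(congr1 val) /= hu; rewrite val_le /=.
  + by apply: (str_l (np_structural B)); apply/eqP.
  + by apply: (str_r (np_structural B)); apply/eqP.
- by apply/eqP; apply: val_inj.
- by move=> u v; apply: val_inj; apply: np_sigM.
- move=> u v; apply: val_inj; rewrite /= /np_mul /= joinEprod /= joinxx.
  congr (_, _); rewrite [X in _ = X `|` _]join_r; last first.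
    by rewrite (lractA HB) -lact_pt; apply/lact_homo_r/rprodP.
  rewrite [X in _ = _ `|` X]join_l; first by rewrite joinC.
  rewrite -(lactM HB) lact_pt (ractM HB) -lact_pt.
  exact/ract_homo_r/rprodP.
- move=> u v; apply: val_inj.
  rewrite /= /np_ldiv /= meetEprod /= meetxx; congr (_, _); apply: eq_lex => c.
  rewrite !lexI !le_ldivS le_pt_ldiv !(le_ract_ldiv HB) -pt_lact_ract.
  case: (boolP ((val u).2 :* c <= (val v).2)) => [h|_]; last by rewrite !andbF.
  by rewrite (le_trans (ract_homo_r _ (rprodP u)) h) !andbT.
- move=> u v; apply: val_inj.
  rewrite /= /np_rdiv /= meetEprod /= meetxx; congr (_, _); apply: eq_lex => c.
  rewrite !lexI !le_rdivS le_pt_ldiv !(le_lact_rdiv HB) -lact_pt (lactM HB).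
  case: (boolP (c *: (val v).2 <= (val u).2)) => [h|_]; last by rewrite !andbF.
  by rewrite (le_trans (lact_homo_r _ (rprodP v)) h) !andbT.
- by move=> u v; apply: val_inj; apply: np_gam_ldiv.
- by move=> u v; apply: val_inj; apply: np_gam_rdiv.
- by move=> u; apply: val_inj; apply: np_sig_gam_l.
- by move=> u; apply: val_inj; apply: np_sig_gam_r.
- by move=> u; apply: val_inj; apply: np_gam_sig_l.
- by move=> u; apply: val_inj; apply: np_gam_sig_r.
Qed.

Fact rp_sig_oplus u v : rp_sig (rp_oplus u v) = rp_sig (u `&` v).
Proof. exact: val_inj. Qed.
Fact rp_gam_oplus u v : rp_gam (rp_oplus u v) = rp_gam (u `|` v).
Proof. exact: val_inj. Qed.

Definition sesquilatticeNagataProduct : restrNagataSesquilattice :=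
  @RestrNagataSesquilattice restrictedNagataProduct rp_oplus
    restrictedNagataProductP rp_sig_oplus rp_gam_oplus.

End RestrictedNagataProduct.

(** The common consequences of the axioms of Nagata lattices and of restricted
    Nagata lattices which make the structural bimodule well defined. *)
Record hasStructuralBimodule (N : nagSig) : Prop := HasStructuralBimodule {
  st_resid : isResidLSemigroup N;
  st_pre : isPreConucleus (@ns_sig N);
  st_clo : isSigmaClosure (@ns_sig N) (@ns_gam N);
  st_str : isStructural (@ns_sig N) (@ns_gam N);
  st_sigU : forall a b : N, a \in img ns_sig -> b \in img ns_sig ->
    a `|` b \in img ns_sig;
  st_gamI : forall x y : N, x \in img ns_gam -> y \in img ns_gam ->
    x `&` y \in img ns_gam;
  st_one : (ns_one : N) \in img ns_sig;
  st_zero : (ns_zero : N) \in img ns_gam;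
  st_mul1a : forall a : N, a \in img ns_sig -> ns_one * a = a;
  st_mula1 : forall a : N, a \in img ns_sig -> a * ns_one = a;
  st_mul1x : forall x : N, x \in img ns_gam -> γ (ns_one * x) = x;
  st_mulx1 : forall x : N, x \in img ns_gam -> γ (x * ns_one) = x;
  st_sig_ldiv : forall a b : N, a \in img ns_sig -> b \in img ns_sig ->
    a * σ (a \ b) <= b;
  st_sig_rdiv : forall a b : N, a \in img ns_sig -> b \in img ns_sig ->
    σ (b / a) * a <= b;
  st_gam_ldiv : forall x y : N, x \in img ns_gam -> y \in img ns_gam ->
    x * σ (x \ y) <= y;
  st_gam_rdiv : forall x y : N, x \in img ns_gam -> y \in img ns_gam ->
    σ (y / x) * x <= y;
  st_mix_ldiv : forall a x : N, a \in img ns_sig -> x \in img ns_gam ->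
    γ (a \ x) = a \ x;
  st_mix_rdiv : forall a x : N, a \in img ns_sig -> x \in img ns_gam ->
    γ (x / a) = x / a;
  st_cyclic : forall a : N, a \in img ns_sig -> γ (a * ns_zero) = γ (ns_zero * a)
}.

Section ResiduatedTheory.
Variables (R : residSig) (HR : isResidLSemigroup R).
Implicit Types x y z : R.

Lemma mulr_homo x y z : x <= y -> x * z <= y * z.
Proof. by rewrite -(le_rdiv HR) => /le_trans; apply; rewrite (le_rdiv HR). Qed.
Lemma mull_homo x y z : x <= y -> z * x <= z * y.
Proof. by rewrite -(le_ldiv HR) => /le_trans; apply; rewrite (le_ldiv HR). Qed.
Lemma mul_homo x y z t : x <= y -> z <= t -> x * z <= y * t.
Proof. by move=> h k; apply: le_trans (mulr_homo _ h) (mull_homo _ k). Qed.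
Lemma mul_ldiv_le x y : x * (x \ y) <= y.
Proof. by rewrite -(le_ldiv HR). Qed.
Lemma rdiv_mul_le x y : (y / x) * x <= y.
Proof. by rewrite -(le_rdiv HR). Qed.

End ResiduatedTheory.

Lemma nagata_structural (N : nagSig) :
  isNagataLattice N -> hasStructuralBimodule N.
Proof.
case=> R [si sI sM] [gi gI gl gr] [strl strr] /eqP o1 z0 sMM gM sI2 gU sU gI2.
move=> sld srd gld grd sgl sgr gsl gsr l1 r1 ll rr.
have sldiv (a b : N) : a \in img ns_sig -> b \in img ns_sig -> a * σ (a \ b) <= b.
  move=> /eqP ea /eqP eb; rewrite -{1}ea -sMM -[X in _ <= X]eb.
  exact/si/mul_ldiv_le.
have srdiv (a b : N) : a \in img ns_sig -> b \in img ns_sig -> σ (b / a) * a <= b.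
  move=> /eqP ea /eqP eb; rewrite -{2}ea -sMM -[X in _ <= X]eb.
  exact/si/rdiv_mul_le.
have inS (x : N) : σ x \in img ns_sig by apply/eqP; apply: sI.
have inG (x : N) : γ x \in img ns_gam by apply/eqP; apply: gI.
have gldiv (x y : N) : x \in img ns_gam -> y \in img ns_gam -> x * σ (x \ y) <= y.
  move=> xG /eqP ey; apply: le_trans (gr _ _ (inS _) xG) _.
  move/eqP: xG => ex; rewrite -{1}ex -[X in _ <= X]ey.
  apply: (@le_trans _ _ (γ (x * (x \ y)))); last exact/gi/mul_ldiv_le.
  by rewrite [X in _ <= X]gM; apply: gi; apply: leUr.
have grdiv (x y : N) : x \in img ns_gam -> y \in img ns_gam -> σ (y / x) * x <= y.
  move=> xG /eqP ey; apply: le_trans (gl _ _ (inS _) xG) _.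
  move/eqP: xG => ex; rewrite -{2}ex -[X in _ <= X]ey.
  apply: (@le_trans _ _ (γ ((y / x) * x))); last exact/gi/rdiv_mul_le.
  by rewrite [X in _ <= X]gM; apply: gi; apply: leUl.
have le1l (x y : N) : ns_one * x <= y -> x <= y.
  by rewrite -(le_rdiv R) => /si; rewrite o1; apply: rr.
have le1r (x y : N) : x * ns_one <= y -> x <= y.
  by rewrite -(le_ldiv R) => /si; rewrite o1; apply: ll.
have oneS : (ns_one : N) \in img ns_sig by apply/eqP.
split=> //.
- by move=> a b /eqP ea /eqP eb; apply/eqP; rewrite sU ea eb.
- by move=> x y /eqP ex /eqP ey; apply/eqP; rewrite gI2 ex ey.
- move=> a aS; apply/le_anti; apply/andP; split; last exact: le1l.
  by apply: le_trans (srdiv a a aS aS); apply: mulr_homo.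
- move=> a aS; apply/le_anti; apply/andP; split; last exact: le1r.
  by apply: le_trans (sldiv a a aS aS); apply: mull_homo.
- move=> x xG; apply/le_anti; apply/andP; split; last exact/le1l/gl.
  rewrite -[X in _ <= X](eqP xG); apply: gi.
  by apply: le_trans (grdiv x x xG xG); apply: mulr_homo.
- move=> x xG; apply/le_anti; apply/andP; split; last exact/le1r/gr.
  rewrite -[X in _ <= X](eqP xG); apply: gi.
  by apply: le_trans (gldiv x x xG xG); apply: mull_homo.
- by move=> a x /eqP ea /eqP ex; rewrite -gld ea ex.
- by move=> a x /eqP ea /eqP ex; rewrite -grd ea ex.
- by move=> a /eqP ea; rewrite -{1}ea -gsr gsl ea.
Qed.

Lemma restricted_structural (N : nagSig) :
  isRestrNagataLattice N -> hasStructuralBimodule N.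
Proof.
case=> [[R m1 m2]] si sI sle slax s1 gi gI gge gstr z0 sM mE ldE rdE gld grd.
move=> sgl sgr gsl gsr.
split=> //.
- split=> // a b /eqP ea /eqP eb; apply/eqP; by rewrite sM ea eb.
- by move=> a b /eqP ea /eqP eb; apply/eqP/le_anti; rewrite sle leUx
    -{1}ea si ?leUl // -{1}eb si ?leUr.
- by move=> x y /eqP ex /eqP ey; apply/eqP/le_anti; rewrite gge lexI
    -{2}ex gi ?leIl // -{2}ey gi ?leIr.
- by apply/eqP.
- by move=> x /eqP ex; rewrite m1.
- by move=> x /eqP ex; rewrite m2.
- by move=> a b _ _; apply: le_trans (mul_ldiv_le R a b); apply: mull_homo.
- by move=> a b _ _; apply: le_trans (rdiv_mul_le R a b); apply: mulr_homo.
- by move=> a b _ _; apply: le_trans (mul_ldiv_le R a b); apply: mull_homo.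
- by move=> a b _ _; apply: le_trans (rdiv_mul_le R a b); apply: mulr_homo.
- by move=> a x /eqP ea /eqP ex; rewrite -gld ea ex.
- by move=> a x /eqP ea /eqP ex; rewrite -grd ea ex.
- by move=> a /eqP ea; rewrite -{1}ea -gsr gsl ea.
Qed.

Record structSig := StructSig {
  ss_sig :> nagSig;
  ss_axioms : hasStructuralBimodule ss_sig }.

Definition Nsig (N : structSig) : Type := {a : N | a \in img ns_sig}.
Definition Ngam (N : structSig) : Type := {x : N | x \in img ns_gam}.

HB.instance Definition _ (N : structSig) := SubType.on (Nsig N).
HB.instance Definition _ (N : structSig) := [Choice of Nsig N by <:].
HB.instance Definition _ (N : structSig) :=
  [SubChoice_isSubPOrder of Nsig N by <: with disp0].
HB.instance Definition _ (N : structSig) := SubType.on (Ngam N).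
HB.instance Definition _ (N : structSig) := [Choice of Ngam N by <:].
HB.instance Definition _ (N : structSig) :=
  [SubChoice_isSubPOrder of Ngam N by <: with disp0].

Section StructuralBimodule.
Variable N : structSig.
Implicit Types (a b c : Nsig N) (x y z : Ngam N).

Let HN := ss_axioms N.
Let R := st_resid HN.

Fact in_sig (m : N) : σ m \in img ns_sig.
Proof. by apply/eqP; apply: (pc_idem (st_pre HN)). Qed.
Fact in_gam (m : N) : γ m \in img ns_gam.
Proof. by apply/eqP; apply: (sc_idem (st_clo HN)). Qed.

Definition toS (m : N) : Nsig N := exist _ (σ m) (in_sig m).
Definition toG (m : N) : Ngam N := exist _ (γ m) (in_gam m).

Definition sb_mul a b : Nsig N :=
  exist _ (val a * val b) (pc_mul (st_pre HN) (valP a) (valP b)).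
Definition sb_join a b : Nsig N :=
  exist _ (val a `|` val b) (st_sigU HN (valP a) (valP b)).
Definition sb_meet a b : Nsig N := toS (val a `&` val b).
Definition sb_ldiv a b : Nsig N := toS (val a \ val b).
Definition sb_rdiv a b : Nsig N := toS (val a / val b).
Definition sb_one : Nsig N := toS ns_one.

Definition sb_meetM x y : Ngam N :=
  exist _ (val x `&` val y) (st_gamI HN (valP x) (valP y)).
Definition sb_joinM x y : Ngam N := toG (val x `|` val y).
Definition sb_lact a x : Ngam N := toG (val a * val x).
Definition sb_ract x a : Ngam N := toG (val x * val a).
Definition sb_lact_ldiv a x : Ngam N := toG (val a \ val x).
Definition sb_lact_rdiv y x : Nsig N := toS (val y / val x).
Definition sb_ract_ldiv x y : Nsig N := toS (val x \ val y).
Definition sb_ract_rdiv x a : Ngam N := toG (val x / val a).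
Definition sb_pt : Ngam N := exist _ ns_zero (st_zero HN).

Lemma sig_val a : σ (val a) = val a. Proof. exact: eqP (valP a). Qed.
Lemma gam_val x : γ (val x) = val x. Proof. exact: eqP (valP x). Qed.

Lemma sig_homo (m n : N) : m <= n -> σ m <= σ n.
Proof. exact: pc_isotone (st_pre HN) _ _. Qed.
Lemma gam_homo (m n : N) : m <= n -> γ m <= γ n.
Proof. exact: sc_isotone (st_clo HN) _ _. Qed.

Lemma leS a b : (a <= b) = (val a <= val b). Proof. by rewrite leEsub. Qed.
Lemma leG x y : (x <= y) = (val x <= val y). Proof. by rewrite leEsub. Qed.

Lemma le_toS a (m : N) : val a <= m -> val a <= σ m.
Proof. by move/sig_homo; rewrite sig_val. Qed.
Lemma toG_le x (m : N) : m <= val x -> γ m <= val x.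
Proof. by move/gam_homo; rewrite gam_val. Qed.

Fact sb_lexI a b c : (a <= sb_meet b c) = (a <= b) && (a <= c).
Proof.
rewrite !leS /= -lexI; apply/idP/idP => [h|]; last exact: le_toS.
rewrite lexI; apply/andP; split; apply: le_trans h _.
- by rewrite -[X in _ <= X]sig_val sig_homo ?leIl.
- by rewrite -[X in _ <= X]sig_val sig_homo ?leIr.
Qed.

Fact sb_leUx a b c : (sb_join a b <= c) = (a <= c) && (b <= c).
Proof. by rewrite !leS /= leUx. Qed.

HB.instance Definition _ :=
  Order.POrder_MeetJoin_isLattice.Build disp0 (Nsig N) sb_lexI sb_leUx.

Fact sb_lexIM x y z : (x <= sb_meetM y z) = (x <= y) && (x <= z).
Proof. by rewrite !leG /= lexI. Qed.

Fact sb_leUxM x y z : (sb_joinM x y <= z) = (x <= z) && (y <= z).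
Proof.
rewrite !leG /= -leUx; apply/idP/idP => [h|]; last exact: toG_le.
rewrite leUx; apply/andP; split; apply: le_trans h.
- by rewrite -[X in X <= _]gam_val gam_homo ?leUl.
- by rewrite -[X in X <= _]gam_val gam_homo ?leUr.
Qed.

HB.instance Definition _ :=
  Order.POrder_MeetJoin_isLattice.Build disp0 (Ngam N) sb_lexIM sb_leUxM.

Definition sb_residSig : residSig :=
  @ResidSig (Nsig N : latType) sb_mul sb_ldiv sb_rdiv.

Fact sb_residP : @isResidLattice sb_residSig sb_one.
Proof.
split; first split=> a b c.
- exact/val_inj/(rmulA R).
- rewrite !leS /= -(le_ldiv R); apply/idP/idP; last exact: le_toS.
  move=> h; rewrite (le_ldiv R).
  exact: le_trans (mull_homo R _ h) (st_sig_ldiv HN (valP a) (valP c)).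
- rewrite !leS /= -(le_rdiv R); apply/idP/idP; last exact: le_toS.
  move=> h; rewrite (le_rdiv R).
  exact: le_trans (mulr_homo R _ h) (st_sig_rdiv HN (valP b) (valP c)).
- move=> a; apply: val_inj; rewrite /= (eqP (st_one HN)).
  exact: st_mul1a (valP a).
- move=> a; apply: val_inj; rewrite /= (eqP (st_one HN)).
  exact: st_mula1 (valP a).
Qed.

Definition sb_scal : residLattice := ResidLattice sb_residP.

Definition structuralBimoduleSig : bimodSig :=
  @BimodSig sb_scal (Ngam N : latType) sb_lact sb_ract
    sb_lact_ldiv sb_lact_rdiv sb_ract_ldiv sb_ract_rdiv sb_pt.

(* Structurality absorbs an inner [γ] lying below an action, as soon as the
   argument itself lies below its image. *)
Lemma gam_lact a (m : N) : m <= γ m -> γ (val a * γ m) = γ (val a * m).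
Proof.
move=> h; apply/le_anti/andP; split; last exact/gam_homo/mull_homo.
rewrite -[X in _ <= X](sc_idem (st_clo HN)).
exact/gam_homo/(str_l (st_str HN))/valP.
Qed.

Lemma gam_ract a (m : N) : m <= γ m -> γ (γ m * val a) = γ (m * val a).
Proof.
move=> h; apply/le_anti/andP; split; last exact/gam_homo/mulr_homo.
rewrite -[X in _ <= X](sc_idem (st_clo HN)).
exact/gam_homo/(str_r (st_str HN))/valP.
Qed.

Let clo_l a x : val a * val x <= γ (val a * val x).
Proof. exact (sc_l (st_clo HN) (valP a) (valP x)). Qed.
Let clo_r a x : val x * val a <= γ (val x * val a).
Proof. exact (sc_r (st_clo HN) (valP a) (valP x)). Qed.

Lemma structuralBimoduleP : isBimodule structuralBimoduleSig.
Proof.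
split=> /=.
- by move=> a b x y; rewrite !leS !leG => h k /=; apply/gam_homo/mul_homo.
- by move=> a b x y; rewrite !leS !leG => h k /=; apply/gam_homo/mul_homo.
- move=> a b x; apply: val_inj; rewrite /= gam_lact; last exact: clo_l.
  by rewrite /= (rmulA R).
- move=> a b x; apply: val_inj; rewrite /= gam_ract; last exact: clo_r.
  by rewrite /= (rmulA R).
- move=> a b x; apply: val_inj; rewrite /= gam_lact; last exact: clo_r.
  rewrite gam_ract; last exact: clo_l.
  by rewrite /= (rmulA R).
- move=> x; apply: val_inj; rewrite /= (eqP (st_one HN)).
  exact: st_mul1x (valP x).
- move=> x; apply: val_inj; rewrite /= (eqP (st_one HN)).
  exact: st_mulx1 (valP x).
- move=> a x y; rewrite !leG /= (st_mix_ldiv HN (valP a) (valP y)).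
  rewrite (le_ldiv R); apply/idP/idP; first exact: toG_le.
  by move=> h; apply: le_trans (clo_l a x) h.
- move=> a x y; rewrite leS leG /=; apply/idP/idP => h.
    apply: toG_le; apply: le_trans (mulr_homo R _ h) _.
    exact: st_gam_rdiv (valP x) (valP y).
  by apply: le_toS; rewrite (le_rdiv R); apply: le_trans (clo_l a x) h.
- move=> a x y; rewrite !leG /= (st_mix_rdiv HN (valP a) (valP y)).
  rewrite (le_rdiv R); apply/idP/idP; first exact: toG_le.
  by move=> h; apply: le_trans (clo_r a x) h.
- move=> a x y; rewrite leS leG /=; apply/idP/idP => h.
    apply: toG_le; apply: le_trans (mull_homo R _ h) _.
    exact: st_gam_ldiv (valP x) (valP y).
  by apply: le_toS; rewrite (le_ldiv R); apply: le_trans (clo_r a x) h.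
- by move=> a; apply: val_inj; apply: (st_cyclic HN (valP a)).
Qed.

Definition structuralBimodule : bimodule := Bimodule structuralBimoduleP.

End StructuralBimodule.

Section ProductMorphism.
Variables (B B' : bimodule) (h : bimodHom B B').
Let hP := bhP h.

Definition np_map (p : nprod B) : nprod B' := (bhS h p.1, bhM h p.2).

Lemma np_map_pt (a : scal B) : bhM h (a *: pt) = bhS h a *: pt.
Proof. by rewrite (bh_lact hP) (bh_pt hP). Qed.

Lemma np_mapP : @isNagHom (nagataProduct B) (nagataProduct B') np_map.
Proof.
split=> [[a x] [b y]|[a x] [b y]|[a x] [b y]|[a x] [b y]|[a x] [b y]|||[a x]|[a x]];
  rewrite /np_map /=.
- by rewrite !meetEprod /= (bhS_meet hP) (bhM_meet hP).
- by rewrite !joinEprod /= (bhS_join hP) (bhM_join hP).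
- by rewrite /np_mul /= (bhS_mul hP) (bhM_join hP) (bh_ract hP) (bh_lact hP).
- by rewrite /np_ldiv /= (bhS_meet hP) (bhS_ldiv hP) (bh_ract_ldiv hP)
    (bh_lact_ldiv hP).
- by rewrite /np_rdiv /= (bhS_meet hP) (bhS_rdiv hP) (bh_lact_rdiv hP)
    (bh_ract_rdiv hP).
- by rewrite (bhS_one hP) (bh_pt hP).
- by rewrite (bh_ract_ldiv hP) (bh_pt hP).
- by rewrite /np_sig /= np_map_pt.
- by rewrite /np_gam /= (bh_ract_ldiv hP) (bh_pt hP).
Qed.

Fact np_map_oplus : {morph np_map : p q / np_oplus p q}.
Proof.
move=> [a x] [b y]; rewrite /= /np_map /np_oplus /=.
by rewrite (bhS_meet hP) (bhM_join hP).
Qed.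

Fact np_map_otimes : {morph np_map : p q / np_otimes p q}.
Proof.
move=> [a x] [b y]; rewrite /= /np_map /np_otimes /=.
by rewrite (bhS_join hP) (bhM_meet hP).
Qed.

Definition bilat_map :
    bilatHom (bilatticeNagataProduct B) (bilatticeNagataProduct B') :=
  @BilatHom (bilatticeNagataProduct B) (bilatticeNagataProduct B')
    np_map np_mapP np_map_oplus np_map_otimes.

Lemma bhM_homo (x y : modl B) : x <= y -> bhM h x <= bhM h y.
Proof. by rewrite !leEmeet -(bhM_meet hP) => /eqP ->. Qed.

Fact restricted_map (u : rprod B) : restricted (np_map (val u)).
Proof. by rewrite restrictedE /= -np_map_pt bhM_homo ?rprodP. Qed.

Definition rp_map (u : rprod B) : rprod B' := rp_of (restricted_map u).

Fact rp_mapP :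
  @isNagHom (restrictedNagataProduct B) (restrictedNagataProduct B') rp_map.
Proof.
have P := np_mapP.
split=> [u v|u v|u v|u v|u v|||u|u]; apply: val_inj.
- exact: nh_meet P _ _.
- exact: nh_join P _ _.
- exact: nh_mul P _ _.
- exact: nh_ldiv P _ _.
- exact: nh_rdiv P _ _.
- exact: nh_one P.
- exact: nh_zero P.
- exact: nh_sig P _.
- exact: nh_gam P _.
Qed.

Fact rp_map_oplus : {morph rp_map : u v / rp_oplus u v}.
Proof. by move=> u v; apply: val_inj; apply: np_map_oplus. Qed.

Definition sesqui_map :
    sesquiHom (sesquilatticeNagataProduct B) (sesquilatticeNagataProduct B') :=
  @SesquiHom (sesquilatticeNagataProduct B) (sesquilatticeNagataProduct B')
    rp_map rp_mapP rp_map_oplus.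

End ProductMorphism.

Definition bilatticeProductF : functor bimodCat bilatCat.
Proof.
refine (@Functor bimodCat bilatCat bilatticeNagataProduct bilat_map _ _).
- by move=> B; apply: bilatHom_eq => -[].
- by move=> A B C g f; apply: bilatHom_eq.
Defined.

Definition sesquilatticeProductF : functor bimodCat sesquiCat.
Proof.
refine (@Functor bimodCat sesquiCat sesquilatticeNagataProduct sesqui_map _ _).
- by move=> B; apply: sesquiHom_eq => u; apply: val_inj; rewrite /= /np_map /= -surjective_pairing.
- by move=> A B C g f; apply: sesquiHom_eq => u; apply: val_inj.
Defined.

Section StructuralMorphism.
Variables (N N' : structSig) (f : N -> N').
Hypothesis fP : isNagHom f.

Fact sig_map (a : Nsig N) : f (val a) \in img ns_sig.
Proof. by apply/eqP; rewrite -(nh_sig fP) sig_val. Qed.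
Fact gam_map (x : Ngam N) : f (val x) \in img ns_gam.
Proof. by apply/eqP; rewrite -(nh_gam fP) gam_val. Qed.

Definition sb_mapS (a : Nsig N) : Nsig N' := exist _ (f (val a)) (sig_map a).
Definition sb_mapM (x : Ngam N) : Ngam N' := exist _ (f (val x)) (gam_map x).

Fact sb_mapP :
  @isBimodHom (structuralBimodule N) (structuralBimodule N') sb_mapS sb_mapM.
Proof.
split=> [a b|a b|a b||a b|a b|x y|x y|a x|a x|a x|x y|x y|a x|];
  apply: val_inj => /=.
- by rewrite (nh_sig fP) (nh_meet fP).
- exact: nh_join fP _ _.
- exact: nh_mul fP _ _.
- by rewrite (nh_sig fP) (nh_one fP).
- by rewrite (nh_sig fP) (nh_ldiv fP).
- by rewrite (nh_sig fP) (nh_rdiv fP).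
- exact: nh_meet fP _ _.
- by rewrite (nh_gam fP) (nh_join fP).
- by rewrite (nh_gam fP) (nh_mul fP).
- by rewrite (nh_gam fP) (nh_mul fP).
- by rewrite (nh_gam fP) (nh_ldiv fP).
- by rewrite (nh_sig fP) (nh_rdiv fP).
- by rewrite (nh_sig fP) (nh_ldiv fP).
- by rewrite (nh_gam fP) (nh_rdiv fP).
- exact: nh_zero fP.
Qed.

Definition sb_map : bimodHom (structuralBimodule N) (structuralBimodule N') :=
  BimodHom sb_mapP.

End StructuralMorphism.

Definition bilat_structSig (N : nagataBilattice) : structSig :=
  StructSig (nagata_structural (nb_axioms N)).
Definition sesqui_structSig (N : restrNagataSesquilattice) : structSig :=
  StructSig (restricted_structural (rn_axioms N)).

Definition bilatticeStructuralF : functor bilatCat bimodCat.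
Proof.
refine (@Functor bilatCat bimodCat
  (fun N => structuralBimodule (bilat_structSig N))
  (fun N N' f => @sb_map (bilat_structSig N) (bilat_structSig N') f (bl_nag f))
  _ _).
- by move=> N; apply: bimodHom_eq => a; apply: val_inj.
- by move=> A B C g f; apply: bimodHom_eq => a; apply: val_inj.
Defined.

Definition sesquilatticeStructuralF : functor sesquiCat bimodCat.
Proof.
refine (@Functor sesquiCat bimodCat
  (fun N => structuralBimodule (sesqui_structSig N))
  (fun N N' f => @sb_map (sesqui_structSig N) (sesqui_structSig N') f (sq_nag f))
  _ _).
- by move=> N; apply: bimodHom_eq => a; apply: val_inj.
- by move=> A B C g f; apply: bimodHom_eq => a; apply: val_inj.
Defined.

(* Main.v *)
(** A Nagata lattice is order-embedded in [N_σ * N_γ] by [m |-> (σ m, γ m)]: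
    if [σ m <= σ n] and [γ m <= γ n] then [1 <= σ (m \ m) <= σ (m \ n)], i.e.
    [m <= n].  The remaining axioms say that this embedding is a homomorphism
    into the Nagata product of the structural bimodule, and in a Nagata
    bilattice a term built from all four lattice operations takes the first
    coordinate from one argument and the second from the other.

    A restricted Nagata sesquilattice turns out to be a Nagata lattice.  The
    missing laws [γ (x `&` y) = γ x `&` γ y] and [σ (x `|` y) = σ x `|` σ y]
    come from [oplus], which exhibits elements with prescribed images under
    [σ] and [γ].  There [oplus (σ m) (γ n)] is the preimage of
    [(σ m, γ n)] as soon as [σ m <= γ n]. *)

Require Import Defs.
From mathcomp Require Import all_boot all_order.
From mathcomp Require Import boolp.

Set Implicit Arguments.
Unset Strict Implicit.
Unset Printing Implicit Defensive.

Import Order.Theory.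
Local Open Scope order_scope.
Local Open Scope nag_scope.

Local Notation "'σ' x" := (ns_sig x) (at level 10, x at level 9).
Local Notation "'γ' x" := (ns_gam x) (at level 10, x at level 9).

(** * Bijective homomorphisms are isomorphisms *)

Lemma inj_surj_bij (A B : Type) (f : A -> B) :
  injective f -> (forall y, exists x, f x = y) -> bijective f.
Proof.
(* Preimages are picked by choice ([cid]), surjectivity being only a propositional existence. *)
move=> fI fS; exists (fun y => sval (cid (fS y))) => [x|y].
  by apply: fI; case: cid.
by case: cid.
Qed.

(** Each law, residuals included, is equational: apply the injective [f] or [g] to both sides and
    cancel. *)
Lemma isBimodHom_can (B B' : bimodSig) (f : scal B -> scal B')
    (g : modl B -> modl B') (f' : scal B' -> scal B) (g' : modl B' -> modl B) :
  isBimodHom f g -> cancel f f' -> cancel f' f -> cancel g g' -> cancel g' g ->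
  isBimodHom f' g'.
Proof.
move=> h fK f'K gK g'K; have fI := can_inj fK; have gI := can_inj gK.
split=> [a b|a b|a b||a b|a b|x y|x y|a x|a x|a x|x y|x y|a x|].
- by apply: fI; rewrite (bhS_meet h) !f'K.
- by apply: fI; rewrite (bhS_join h) !f'K.
- by apply: fI; rewrite (bhS_mul h) !f'K.
- by apply: fI; rewrite (bhS_one h) !f'K.
- by apply: fI; rewrite (bhS_ldiv h) !f'K.
- by apply: fI; rewrite (bhS_rdiv h) !f'K.
- by apply: gI; rewrite (bhM_meet h) !g'K.
- by apply: gI; rewrite (bhM_join h) !g'K.
- by apply: gI; rewrite (bh_lact h) f'K !g'K.
- by apply: gI; rewrite (bh_ract h) f'K !g'K.
- by apply: gI; rewrite (bh_lact_ldiv h) f'K !g'K.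
- by apply: fI; rewrite (bh_lact_rdiv h) f'K !g'K.
- by apply: fI; rewrite (bh_ract_ldiv h) f'K !g'K.
- by apply: gI; rewrite (bh_ract_rdiv h) f'K !g'K.
- by apply: gI; rewrite (bh_pt h) !g'K.
Qed.

Lemma isNagHom_can (N N' : nagSig) (f : N -> N') (g : N' -> N) :
  isNagHom f -> cancel f g -> cancel g f -> isNagHom g.
Proof.
move=> h fK gK; have fI := can_inj fK.
split=> [x y|x y|x y|x y|x y|||x|x]; apply: fI.
- by rewrite (nh_meet h) !gK.
- by rewrite (nh_join h) !gK.
- by rewrite (nh_mul h) !gK.
- by rewrite (nh_ldiv h) !gK.
- by rewrite (nh_rdiv h) !gK.
- by rewrite (nh_one h) !gK.
- by rewrite (nh_zero h) !gK.
- by rewrite (nh_sig h) !gK.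
- by rewrite (nh_gam h) !gK.
Qed.

Lemma bilat_isomorphism (N N' : nagataBilattice) (f : bilatHom N N') :
  bijective f -> @isomorphism bilatCat _ _ f.
Proof.
case=> g fK gK; have fI := can_inj fK.
have gp : {morph g : x y / nb_oplus x y}.
  by move=> x y; apply: fI; rewrite bl_oplus !gK.
have gt : {morph g : x y / nb_otimes x y}.
  by move=> x y; apply: fI; rewrite bl_otimes !gK.
by exists (BilatHom (isNagHom_can (bl_nag f) fK gK) gp gt); split;
  apply: bilatHom_eq.
Qed.

Lemma sesqui_isomorphism (N N' : restrNagataSesquilattice)
    (f : sesquiHom N N') :
  bijective f -> @isomorphism sesquiCat _ _ f.
Proof.
case=> g fK gK; have fI := can_inj fK.
have gp : {morph g : x y / rn_oplus x y}.
  by move=> x y; apply: fI; rewrite sq_oplus !gK.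
by exists (SesquiHom (isNagHom_can (sq_nag f) fK gK) gp); split;
  apply: sesquiHom_eq.
Qed.

(** * Restricted Nagata sesquilattices are Nagata lattices *)

Section RestrictedIsNagata.
Variable N : restrNagataSesquilattice.
Implicit Types x y m n : N.

Let P := rn_axioms N.
Let RL := rres P.
Let R := rl_lsemigroup RL.

(** [m <= n] means [1 <= m \ n], and [rldivE] splits this into [σ m <= n] and [m <= γ n]. *)
Lemma restr_le m n : σ m <= σ n -> γ m <= γ n -> m <= n.
Proof.
move=> hs hg; rewrite -[m in m <= _](rmulx1 RL) -(le_ldiv R) -(rldivE P) lexI.
rewrite !(le_ldiv R) !(rmulx1 RL) (le_trans hs (rsig_le P n)).
exact: le_trans (rgam_ge P m) hg.
Qed.

Lemma le_rsig x m : σ x = x -> x <= m -> x <= σ m.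
Proof. by move=> {2}<-; apply: (rsig_isotone P). Qed.

Lemma restr_sigI x y : σ (x `&` y) = σ (σ x `&` σ y).
Proof.
apply/le_anti/andP; split; last by rewrite (rsig_isotone P) ?leI2 ?(rsig_le P).
rewrite le_rsig ?(rsig_idem P) // lexI.
by rewrite !(rsig_isotone P) ?leIl ?leIr.
Qed.

Lemma restr_gamU x y : γ (x `|` y) = γ (γ x `|` γ y).
Proof.
apply/le_anti/andP; split; first by rewrite (rgam_isotone P) ?leU2 ?(rgam_ge P).
rewrite -[X in _ <= X](rgam_idem P) (rgam_isotone P) // leUx.
by rewrite !(rgam_isotone P) ?leUl ?leUr.
Qed.

(* The element [oplus (x `&` y) (γ x `&` γ y)] has the same image under [σ] as
   [x `&` y] and is sent by [γ] to [γ x `&` γ y], so it is below [x] and [y]. *)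
Lemma restr_gamI x y : γ (x `&` y) = γ x `&` γ y.
Proof.
set t := γ x `&` γ y.
have le_t : x `&` y <= t by rewrite leI2 ?(rgam_ge P).
have gt : γ t = t.
  apply/le_anti; rewrite (rgam_ge P) lexI -{1}(rgam_idem P x) -{1}(rgam_idem P y).
  by rewrite !(rgam_isotone P) ?leIl ?leIr.
apply/le_anti; rewrite -{1}gt (rgam_isotone P) //=.
pose p := rn_oplus (x `&` y) t.
have sp : σ p = σ (x `&` y) by rewrite rn_sig_oplus meet_l.
have gp : γ p = t by rewrite rn_gam_oplus join_r.
rewrite -gp (rgam_isotone P) // lexI.
apply/andP; split; apply: restr_le; rewrite ?sp ?gp ?leIl ?leIr //.
  by rewrite (rsig_isotone P) ?leIl.
by rewrite (rsig_isotone P) ?leIr.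
Qed.

(* Dually, [oplus (σ x `|` σ y) (x `|` y)] lies above [x] and [y]. *)
Lemma restr_sigU x y : σ (x `|` y) = σ x `|` σ y.
Proof.
set s := σ x `|` σ y.
have s_le : s <= x `|` y by rewrite leU2 ?(rsig_le P).
have ss : σ s = s.
  apply/le_anti; rewrite (rsig_le P) leUx -{1}(rsig_idem P x) -{1}(rsig_idem P y).
  by rewrite !(rsig_isotone P) ?leUl ?leUr.
apply/le_anti; rewrite -{2}ss (rsig_isotone P) // andbT.
pose q := rn_oplus s (x `|` y).
have sq : σ q = s by rewrite rn_sig_oplus meet_l.
have gq : γ q = γ (x `|` y) by rewrite rn_gam_oplus join_r.
rewrite -sq (rsig_isotone P) // leUx.
apply/andP; split; apply: restr_le; rewrite ?sq ?gq ?leUl ?leUr //.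
  by rewrite (rgam_isotone P) ?leUl.
by rewrite (rgam_isotone P) ?leUr.
Qed.

Lemma sig_in x : σ x \in img ns_sig.
Proof. by apply/eqP; apply: (rsig_idem P). Qed.

(** [rmulE] expands the product; one inequality is extensivity of [γ], the other is structurality,
    which moves the inner [γ] outside each product. *)
Lemma restr_gamM x y : γ (x * y) = γ (σ x * γ y `|` γ x * σ y).
Proof.
apply/le_anti; rewrite (rmulE P x y) (rgam_isotone P) /=; last first.
  by rewrite leU2 ?(mull_homo R) ?(mulr_homo R) ?(rgam_ge P).
rewrite -[X in _ <= X](rgam_idem P) (rgam_isotone P) // leUx.
rewrite (le_trans (str_l (rstructural P) _ (sig_in x))) ?(rgam_isotone P) ?leUl //.
by rewrite (le_trans (str_r (rstructural P) _ (sig_in y))) ?(rgam_isotone P) ?leUr.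
Qed.

(** Upwards, multiply by [σ (x \ y)]: [σ] is multiplicative, and [γ x * σ (x \ y) <= γ y] by
    structurality. Downwards, the meet lies below [σ x \ y] and [x \ γ y], whose meet is [x \ y] by
    [rldivE]. *)
Lemma restr_sig_ldiv x y : σ (x \ y) = σ (σ x \ σ y `&` γ x \ γ y).
Proof.
apply/le_anti/andP; split; apply: le_rsig; rewrite ?(rsig_idem P) //.
  rewrite lexI !(le_ldiv R) -(rsigM P) (rsig_isotone P) ?(mul_ldiv_le R) //.
  apply: le_trans (str_r (rstructural P) _ (sig_in _)) (rgam_isotone P _).
  exact: le_trans (mull_homo R _ (rsig_le P _)) (mul_ldiv_le R _ _).
apply: le_trans (rsig_le P _) _; rewrite -(rldivE P x y) leI2 //.
  rewrite (le_ldiv R); apply: le_trans (rsig_le P y).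
  exact: mul_ldiv_le R _ _.
rewrite (le_ldiv R); apply: le_trans (mul_ldiv_le R (γ x) (γ y)).
exact/(mulr_homo R)/(rgam_ge P).
Qed.

Lemma restr_sig_rdiv x y : σ (y / x) = σ (σ y / σ x `&` γ y / γ x).
Proof.
apply/le_anti/andP; split; apply: le_rsig; rewrite ?(rsig_idem P) //.
  rewrite lexI !(le_rdiv R) -(rsigM P) (rsig_isotone P) ?(rdiv_mul_le R) //.
  apply: le_trans (str_l (rstructural P) _ (sig_in _)) (rgam_isotone P _).
  exact: le_trans (mulr_homo R _ (rsig_le P _)) (rdiv_mul_le R _ _).
apply: le_trans (rsig_le P _) _; rewrite -(rrdivE P y x) leI2 //.
  rewrite (le_rdiv R); apply: le_trans (rsig_le P y).
  exact: rdiv_mul_le R _ _.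
rewrite (le_rdiv R); apply: le_trans (rdiv_mul_le R (γ x) (γ y)).
exact/(mull_homo R)/(rgam_ge P).
Qed.

Lemma restricted_nagata : isNagataLattice N.
Proof.
(* As [1] is fixed by the interior operator [σ], it lies below [σ (x \ y)] exactly when it lies
   below [x \ y]. This yields the four axioms relating [1] to the order. *)
have le1 x y : (ns_one <= σ (x \ y)) = (x <= y).
  rewrite -{2}[x](rmulx1 RL) -(le_ldiv R).
  apply/idP/idP => [|h]; last by rewrite le_rsig ?(rsig_one P).
  by move/le_trans; apply; apply: (rsig_le P).
have le1' x y : (ns_one <= σ (y / x)) = (x <= y).
  rewrite -{2}[x](rmul1x RL) -(le_rdiv R).
  apply/idP/idP => [|h]; last by rewrite le_rsig ?(rsig_one P).
  by move/le_trans; apply; apply: (rsig_le P).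
have S := restricted_structural P.
split; [exact: R | exact: st_pre S | exact: st_clo S | exact: st_str S
  | exact: st_one S | exact: st_zero S | exact: rsigM P | exact: restr_gamM
  | exact: restr_sigI | exact: restr_gamU | exact: restr_sigU
  | exact: restr_gamI | exact: restr_sig_ldiv | exact: restr_sig_rdiv
  | exact: rgam_ldiv P | exact: rgam_rdiv P | exact: rsig_gam_l P
  | exact: rsig_gam_r P | exact: rgam_sig_l P | exact: rgam_sig_r P
  | | | |].
- by move=> x; rewrite le1.
- by move=> x; rewrite le1'.
- by move=> x y; rewrite le1.
- by move=> x y; rewrite le1'.
Qed.

End RestrictedIsNagata.

(** * Embedding a Nagata lattice into the Nagata product of its structural bimodule *)

Section Unit.
Variable N : structSig.
Hypothesis P : isNagataLattice N.
Implicit Types m n : N.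

Let R := nres P.

Lemma nagata_le m n : σ m <= σ n -> γ m <= γ n -> m <= n.
Proof.
move=> hs hg; apply: (nle_ldiv P); apply: le_trans (nle1_ldiv P m) _.
(* By [nsig_ldiv], [σ (m \ n)] depends only on the images of [m] and [n] under [σ] and [γ]. *)
rewrite !(nsig_ldiv P); apply: (pc_isotone (npreconucleus P)).
rewrite leI2 // (le_ldiv R).
  exact: le_trans (mul_ldiv_le R _ _) hs.
exact: le_trans (mul_ldiv_le R _ _) hg.
Qed.

Lemma nagata_eq m n : σ m = σ n -> γ m = γ n -> m = n.
Proof.
by move=> hs hg; apply/le_anti/andP; split; apply: nagata_le; rewrite ?hs ?hg.
Qed.

Lemma toS_meet m n : toS (m `&` n) = toS m `&` toS n.
Proof. exact/val_inj/(nsigI P). Qed.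
Lemma toS_join m n : toS (m `|` n) = toS m `|` toS n.
Proof. exact/val_inj/(nsigU P). Qed.
Lemma toG_meet m n : toG (m `&` n) = toG m `&` toG n.
Proof. exact/val_inj/(ngamI P). Qed.
Lemma toG_join m n : toG (m `|` n) = toG m `|` toG n.
Proof. exact/val_inj/(ngamU P). Qed.

(** [γ 1 = γ (σ 1) = γ (0 * 1) = 0]; this makes the unit map send [1] to the pair of [1] and [0]. *)
Lemma gam_one : γ ns_one = ns_zero :> N.
Proof.
have S := nagata_structural P.
by rewrite -[in LHS](eqP (st_one S)) (ngam_sig_l P) (eqP (st_one S))
  (st_mulx1 S (st_zero S)).
Qed.

(** Stated over [structSig] so that it serves bilattices directly and sesquilattices after
    corestriction. *)
Definition unit_map m : nprod (structuralBimodule N) := (toS m, toG m).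

Lemma unit_mapP : @isNagHom N (nagataProduct (structuralBimodule N)) unit_map.
Proof.
split=> [m n|m n|m n|m n|m n|||m|m]; congr (_, _).
- exact: toS_meet.
- exact: toG_meet.
- exact: toS_join.
- exact: toG_join.
- exact/val_inj/(nsigM P).
- by apply: val_inj; rewrite /= -(ngamU P) (ngamM P) joinC.
(* The meet of [N_σ] carries an outer [σ], so [nsigI] removes the [σ] around each residual. *)
- by apply: val_inj; rewrite /= -(nsigI P) (nsig_ldiv P).
- by apply: val_inj; rewrite /= (ngam_ldiv P) (sc_idem (nclosure P)).
- by apply: val_inj; rewrite /= -(nsigI P) (nsig_rdiv P).
- by apply: val_inj; rewrite /= (ngam_rdiv P) (sc_idem (nclosure P)).
- exact/val_inj/gam_one.
- by apply: val_inj; rewrite /= -{1}(eqP (nzero_gam P)) (nsig_gam_l P)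
    (eqP (nzero_gam P)).
- exact/val_inj/(eqP (nzero_gam P)).
- exact/val_inj/(pc_idem (npreconucleus P)).
- exact/val_inj/(ngam_sig_r P).
- exact/val_inj/(nsig_gam_l P).
- exact/val_inj/(sc_idem (nclosure P)).
Qed.

Lemma unit_map_inj : injective unit_map.
Proof. by move=> m n [hs hg]; apply: nagata_eq. Qed.

End Unit.

(** * The unit for Nagata bilattices *)

Section BilatticeUnit.
Variable N : nagataBilattice.

Let M := bilat_structSig N.
Let P : isNagataLattice M := nb_axioms N.

Lemma toS_oplus (m n : M) : toS (nb_oplus m n : M) = toS m `&` toS n.
Proof. by rewrite -(toS_meet P); apply: val_inj; apply: nb_sig_oplus. Qed.
Lemma toG_oplus (m n : M) : toG (nb_oplus m n : M) = toG m `|` toG n.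
Proof. by rewrite -(toG_join P); apply: val_inj; apply: nb_gam_oplus. Qed.
Lemma toS_otimes (m n : M) : toS (nb_otimes m n : M) = toS m `|` toS n.
Proof. by rewrite -(toS_join P); apply: val_inj; apply: nb_sig_otimes. Qed.
Lemma toG_otimes (m n : M) : toG (nb_otimes m n : M) = toG m `&` toG n.
Proof. by rewrite -(toG_meet P); apply: val_inj; apply: nb_gam_otimes. Qed.

Fact bilat_unit_oplus :
  {morph @unit_map M : m n / (nb_oplus (m : N) n : M) >-> np_oplus m n}.
Proof. by move=> m n; rewrite /unit_map toS_oplus toG_oplus. Qed.

Fact bilat_unit_otimes :
  {morph @unit_map M : m n / (nb_otimes (m : N) n : M) >-> np_otimes m n}.
Proof. by move=> m n; rewrite /unit_map toS_otimes toG_otimes. Qed.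

Definition bilat_unit :
    bilatHom N (bilatticeProductF (bilatticeStructuralF N)) :=
  @BilatHom N (bilatticeNagataProduct (structuralBimodule M)) (@unit_map M)
    (unit_mapP P) bilat_unit_oplus bilat_unit_otimes.

(* [(a, b)] and [(c, d)] are combined into [(a, d)] as the join of
   [(a, b `&` d)] and [(a `&` c, d)]. *)
Lemma bilat_unit_bij : bijective bilat_unit.
Proof.
apply: inj_surj_bij; first exact: (unit_map_inj P).
move=> [a x]; pose p : M := val a; pose q : M := val x.
have ea : toS p = a by apply: val_inj; apply: sig_val.
have ex : toG q = x by apply: val_inj; apply: gam_val.
exists (p `&` nb_otimes p q `|` q `&` nb_oplus p q : M).
congr (_, _).
  rewrite (toS_join P) !(toS_meet P) toS_otimes toS_oplus ea.
  by rewrite [X in X `|` _]meet_l ?leUl // join_l // meetCA leIl.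
rewrite (toG_join P) !(toG_meet P) toG_otimes toG_oplus ex.
by rewrite [X in _ `|` X]meet_l ?leUr // join_r // meetA leIr.
Qed.

End BilatticeUnit.

(** * The unit for restricted Nagata sesquilattices *)

Section SesquilatticeUnit.
Variable N : restrNagataSesquilattice.

Let M := sesqui_structSig N.
Let P := rn_axioms N.
Let NP : isNagataLattice M := restricted_nagata N.

(** The condition reads [γ (σ m * 0) <= γ m], and the left side is [γ (σ m)]. *)
Fact restricted_unit (m : M) : restricted (unit_map m).
Proof.
rewrite restrictedE leG /= -(ngam_sig_r NP).
exact/(rgam_isotone P)/(rsig_le P).
Qed.

Definition sesqui_unit_map (m : M) : rprod (structuralBimodule M) :=
  rp_of (restricted_unit m).

Fact sesqui_unit_mapP :
  @isNagHom N (restrictedNagataProduct (structuralBimodule M)) sesqui_unit_map.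
Proof.
have U := unit_mapP NP.
split=> [m n|m n|m n|m n|m n|||m|m]; apply: val_inj.
- exact: nh_meet U _ _.
- exact: nh_join U _ _.
- exact: nh_mul U _ _.
- exact: nh_ldiv U _ _.
- exact: nh_rdiv U _ _.
- exact: nh_one U.
- exact: nh_zero U.
- exact: nh_sig U _.
- exact: nh_gam U _.
Qed.

Fact sesqui_unit_oplus :
  {morph sesqui_unit_map : m n / (rn_oplus (m : N) n : M) >-> rp_oplus m n}.
Proof.
move=> m n; apply: val_inj; rewrite /= /unit_map /np_oplus /=.
rewrite -(toS_meet NP) -(toG_join NP).
by congr (_, _); apply: val_inj; [apply: rn_sig_oplus | apply: rn_gam_oplus].
Qed.

Definition sesqui_unit :
    sesquiHom N (sesquilatticeProductF (sesquilatticeStructuralF N)) :=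
  @SesquiHom N (sesquilatticeNagataProduct (structuralBimodule M))
    sesqui_unit_map sesqui_unit_mapP sesqui_unit_oplus.

Lemma sesqui_unit_bij : bijective sesqui_unit.
Proof.
apply: inj_surj_bij.
  by move=> m n /(congr1 val); apply: (unit_map_inj NP).
move=> u; have := rprodP u; rewrite leG /=.
(* Restrictedness, [γ (a * 0) <= x], becomes [γ a <= x], hence [a <= x]; this is what makes [oplus]
   of [a] and [x] a preimage. *)
case: u => -[a x] /= ax; rewrite -{1}(sig_val a) -(ngam_sig_r NP) sig_val => le_ax.
have {}le_ax : val a <= val x := le_trans (rgam_ge P _) le_ax.
exists (rn_oplus (val a : N) (val x)); apply: val_inj; congr (_, _); apply: val_inj.
  by rewrite /= rn_sig_oplus meet_l //; apply: (@sig_val M).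
by rewrite /= rn_gam_oplus join_r //; apply: (@gam_val M).
Qed.

End SesquilatticeUnit.

(** * The counit and its inverse *)

Section Counit.
Variable B : bimodule.

Let M := bilat_structSig (bilatticeNagataProduct B).
Let M' := sesqui_structSig (sesquilatticeNagataProduct B).

Lemma Nsig_prod (a : Nsig M) : val a = np_sig (val a).
Proof. by rewrite [RHS](sig_val a). Qed.
Lemma Ngam_prod (x : Ngam M) : val x = np_gam (val x).
Proof. by rewrite [RHS](gam_val x). Qed.

Definition counitS (a : Nsig M) : scal B := (val a : nprod B).1.
Definition counitM (x : Ngam M) : modl B := (val x : nprod B).2.

(** Most laws hold by computation. In the six others a component of the product or residual has an
    extra term, absorbed once the arguments are written as values of [np_sig] and [np_gam]. *)
Lemma counitP : @isBimodHom (structuralBimodule M) B counitS counitM.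
Proof.
rewrite /counitS /counitM; split=> // [a b|a b|a x|a x|x y|x y] /=.
- exact: etrans (f_equal2 (fun p q => (np_ldiv p q).1) (Nsig_prod a)
    (Nsig_prod b)) (np_ldiv_sig _ _).
- exact: etrans (f_equal2 (fun p q => (np_rdiv p q).1) (Nsig_prod a)
    (Nsig_prod b)) (np_rdiv_sig _ _).
- exact: etrans (f_equal2 (fun p q => (np_mul p q).2) (Nsig_prod a)
    (Ngam_prod x)) (congr1 snd (np_sig_gamE _ _)).
- exact: etrans (f_equal2 (fun p q => (np_mul q p).2) (Nsig_prod a)
    (Ngam_prod x)) (congr1 snd (np_gam_sigE _ _)).
- exact: etrans (f_equal2 (fun p q => (np_rdiv q p).1) (Ngam_prod x)
    (Ngam_prod y)) (np_rdiv_gam _ _).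
- exact: etrans (f_equal2 (fun p q => (np_ldiv p q).1) (Ngam_prod x)
    (Ngam_prod y)) (np_ldiv_gam _ _).
Qed.

Definition bilat_counit :
    bimodHom (bilatticeStructuralF (bilatticeProductF B)) B :=
  BimodHom counitP.

Fact val_rprodP :
  @isNagHom (restrictedNagataProduct B) (nagataProduct B) val.
Proof. by []. Qed.

(** The restricted product is a subalgebra of the full one, so its inclusion induces a bimodule
    morphism to compose with [bilat_counit]. *)
Definition sesqui_counit :
    bimodHom (sesquilatticeStructuralF (sesquilatticeProductF B)) B :=
  bimodHom_comp bilat_counit (@sb_map M' M val val_rprodP).

(** [eS a] is already a fixed point; [toS] only supplies the membership proof and leaves the value
    unchanged by conversion. *)
Definition embS (a : scal B) : Nsig M := toS (eS a : M).
Definition embM (x : modl B) : Ngam M := toG (eM x : M).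

Lemma counitSK : cancel counitS embS.
Proof. by move=> a; apply: val_inj; rewrite /= [RHS]Nsig_prod. Qed.
Lemma counitMK : cancel counitM embM.
Proof. by move=> x; apply: val_inj; rewrite /= [RHS]Ngam_prod. Qed.

Definition bilat_emb :
    bimodHom B (bilatticeStructuralF (bilatticeProductF B)) :=
  @BimodHom B (structuralBimodule M) embS embM
    (isBimodHom_can counitP counitSK (fun=> erefl) counitMK (fun=> erefl)).

Lemma bilat_embK : @inverses bimodCat _ _ bilat_emb bilat_counit.
Proof.
by split; apply: bimodHom_eq => // a; [apply: counitSK | apply: counitMK].
Qed.

Definition rp_embS (a : scal B) : Nsig M' :=
  toS (rp_of (restricted_sig (eS a)) : M').
Definition rp_embM (x : modl B) : Ngam M' :=
  toG (rp_of (restricted_gam (eM x)) : M').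

Lemma sesqui_counitSK : cancel (bhS sesqui_counit) rp_embS.
Proof.
(* Two subtypes are nested: fixed points of [σ] inside the restricted product. *)
move=> a; do 2!apply: val_inj.
by have /(congr1 val) := sig_val a.
Qed.
Lemma sesqui_counitMK : cancel (bhM sesqui_counit) rp_embM.
Proof.
move=> x; do 2!apply: val_inj.
by have /(congr1 val) := gam_val x.
Qed.

Definition sesqui_emb :
    bimodHom B (sesquilatticeStructuralF (sesquilatticeProductF B)) :=
  @BimodHom B (structuralBimodule M') rp_embS rp_embM
    (isBimodHom_can (bhP sesqui_counit) sesqui_counitSK (fun=> erefl)
      sesqui_counitMK (fun=> erefl)).

Lemma sesqui_embK : @inverses bimodCat _ _ sesqui_emb sesqui_counit.
Proof.
by split; apply: bimodHom_eq => // a;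
  [apply: sesqui_counitSK | apply: sesqui_counitMK].
Qed.

End Counit.

(** * Naturality, triangle identities and the equivalences *)

Definition bilat_unitN :
  natTrans (idF bilatCat) (compF bilatticeProductF bilatticeStructuralF).
Proof.
refine (@NatTrans _ _ (idF bilatCat)
  (compF bilatticeProductF bilatticeStructuralF) bilat_unit _).
move=> N N' f; apply: bilatHom_eq => m; congr (_, _); apply: val_inj.
  by rewrite /= (nh_sig (bl_nag f)).
by rewrite /= (nh_gam (bl_nag f)).
Defined.

Definition bilat_counitN :
  natTrans (compF bilatticeStructuralF bilatticeProductF) (idF bimodCat).
Proof.
refine (@NatTrans _ _ (compF bilatticeStructuralF bilatticeProductF)
  (idF bimodCat) bilat_counit _).
by move=> B B' f; apply: bimodHom_eq.
Defined.

Definition sesqui_unitN :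
  natTrans (idF sesquiCat)
    (compF sesquilatticeProductF sesquilatticeStructuralF).
Proof.
refine (@NatTrans _ _ (idF sesquiCat)
  (compF sesquilatticeProductF sesquilatticeStructuralF) sesqui_unit _).
move=> N N' f; apply: sesquiHom_eq => m; apply: val_inj.
congr (_, _); apply: val_inj.
  by rewrite /= (nh_sig (sq_nag f)).
by rewrite /= (nh_gam (sq_nag f)).
Defined.

Definition sesqui_counitN :
  natTrans (compF sesquilatticeStructuralF sesquilatticeProductF)
    (idF bimodCat).
Proof.
refine (@NatTrans _ _ (compF sesquilatticeStructuralF sesquilatticeProductF)
  (idF bimodCat) sesqui_counit _).
by move=> B B' f; apply: bimodHom_eq.
Defined.

Lemma bilat_equivalence : equivalence bilat_unitN bilat_counitN.
Proof.
split.
- by move=> N; apply/bilat_isomorphism/bilat_unit_bij.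
- by move=> B; exists (bilat_emb B); have [? ?] := bilat_embK B; split.
(* The composite sends [a] to [σ a] and [x] to [γ x], which are [a] and [x] since both are fixed
   points. *)
- move=> N; apply: bimodHom_eq => [a|x]; apply: val_inj.
    exact: (@sig_val (bilat_structSig N)).
  exact: (@gam_val (bilat_structSig N)).
- by move=> B; apply: bilatHom_eq => -[].
Qed.

Lemma sesqui_equivalence : equivalence sesqui_unitN sesqui_counitN.
Proof.
split.
- by move=> N; apply/sesqui_isomorphism/sesqui_unit_bij.
- by move=> B; exists (sesqui_emb B); have [? ?] := sesqui_embK B; split.
- move=> N; apply: bimodHom_eq => [a|x]; apply: val_inj.
    exact: (@sig_val (sesqui_structSig N)).
  exact: (@gam_val (sesqui_structSig N)).
- by move=> B; apply: sesquiHom_eq => -[[a x] ax]; apply: val_inj.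
Qed.

Theorem mainTheorem3 :
  (exists (eta : natTrans (idF bilatCat)
                   (compF bilatticeProductF bilatticeStructuralF))
          (eps : natTrans (compF bilatticeStructuralF bilatticeProductF)
                   (idF bimodCat)),
     [/\ equivalence eta eps,
         forall (N : nagataBilattice) (m : N),
           sval (bl_fun (eta N) m).1 = ns_sig m /\
           sval (bl_fun (eta N) m).2 = ns_gam m
       & forall B : bimodule,
           exists e : bimodHom B (bilatticeStructuralF (bilatticeProductF B)),
             [/\ forall a : scal B, sval (bhS e a) = eS a,
                 forall x : modl B, sval (bhM e x) = eM x
               & @inverses bimodCat _ _ e (eps B)]])
  /\
  (exists (eta : natTrans (idF sesquiCat)
                   (compF sesquilatticeProductF sesquilatticeStructuralF))
          (eps : natTrans (compF sesquilatticeStructuralF sesquilatticeProductF)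
                   (idF bimodCat)),
     [/\ equivalence eta eps,
         forall (N : restrNagataSesquilattice) (m : N),
           sval (sval (sq_fun (eta N) m)).1 = ns_sig m /\
           sval (sval (sq_fun (eta N) m)).2 = ns_gam m
       & forall B : bimodule,
           exists e :
               bimodHom B (sesquilatticeStructuralF (sesquilatticeProductF B)),
             [/\ forall a : scal B, sval (sval (bhS e a)) = eS a,
                 forall x : modl B, sval (sval (bhM e x)) = eM x
               & @inverses bimodCat _ _ e (eps B)]]).
Proof.
split.
- exists bilat_unitN, bilat_counitN; split=> //; first exact: bilat_equivalence.
  by move=> B; exists (bilat_emb B); split=> //; apply: bilat_embK.
- exists sesqui_unitN, sesqui_counitN; split=> //.
    exact: sesqui_equivalence.
  by move=> B; exists (sesqui_emb B); split=> //; apply: sesqui_embK.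
Qed.
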